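(* Let $n$ be a positive integer and let $\Lambda$ be a basic $(n+1)$-Gorenstein Artin algebra. Then $\Lambda$ is a minimal $n$-Auslander-Gorenstein algebra if and only if $$\mathrm{prinj}(\Lambda)=\{I\in\Lambda\text{-mod}\mid I\text{ is injective and }\mathrm{Gpd}(\mathrm{soc}\,I)\le n\}.$$
   Context: All modules are finitely generated left modules; $\Lambda\text{-mod}$ is the category of finitely generated left $\Lambda$-modules. An Artin algebra $\Lambda$ is $m$-Gorenstein if its left and right regular modules have injective dimension equal to $m$. For a minimal injective coresolution $0\to\Lambda\to I_0\to I_1\to\cdots$ of the left regular module, the dominant dimension $\mathrm{domdim}\,\Lambda$ is the supremum of the integers $d\ge 0$ such that $I_j$ is projective for all $0\le j<d$. An Artin algebra $\Lambda$ is a minimal $n$-Auslander-Gorenstein algebra if $\mathrm{id}\,{}_\Lambda\Lambda\le n+1\le\mathrm{domdim}\,\Lambda$, where $\mathrm{id}$ is injective dimension. $\mathrm{prinj}(\Lambda)$ is the full subcategory of $\Lambda\text{-mod}$ of modules that are both projective and injective. $\mathrm{soc}$ denotes the socle. $\mathrm{Gpd}$ denotes the Gorenstein projective dimension: a module is Gorenstein projective if it is a syzygy (image of a differential) of an exact complex of finitely generated projective modules that stays exact after applying $\mathrm{Hom}_\Lambda(-,\Lambda)$, and $\mathrm{Gpd}\,N$ is the minimal length of a resolution of $N$ by Gorenstein projective modules ($\infty$ if no finite one exists); the zero module is regarded as having $\mathrm{Gpd}\le n$. *)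

(* Defs.v *)
From HB Require Import structures.
From mathcomp Require Import all_boot all_algebra.
From mathcomp Require Import boolp classical_sets.

Set Implicit Arguments.
Unset Strict Implicit.
Unset Printing Implicit Defensive.

Import GRing.Theory.
Local Open Scope classical_set_scope.
Local Open Scope ring_scope.

(* A left R-module is an [lmodType R]; the left and right regular modules of R
   are [R^o : lmodType R] and [R^c^o : lmodType R^c], where R^c is the opposite
   ring.  A submodule of M is an [S : submodClosed M]. *)

Definition submod (R : pzRingType) (M : lmodType R) (S : submodClosed M) : Type :=
  {x : M | x \in S}.

HB.instance Definition _ (R : pzRingType) (M : lmodType R) (S : submodClosed M) :=
  SubChoice.copy (submod S) {x : M | x \in S}.
HB.instance Definition _ (R : pzRingType) (M : lmodType R) (S : submodClosed M) :=
  [SubChoice_isSubLmodule of submod S by <:].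

Section Modules.
Context {R : pzRingType}.
Implicit Types M N : lmodType R.

Definition fin_gen M : Prop :=
  exists (r : nat) (g : 'I_r -> M),
    forall x : M, exists c : 'I_r -> R, x = \sum_(i < r) c i *: g i.

Definition zero_module M : Prop := forall x : M, x = 0.

Definition isomorphic M N : Prop := exists f : {linear M -> N}, bijective f.

Definition artinian_module M : Prop :=
  forall S : nat -> submodClosed M,
    (forall i, {subset S i.+1 <= S i}) ->
    exists m, forall i, (m <= i)%N -> S i =i S m.

Definition simple_module M : Prop :=
  ~ zero_module M /\
  forall S : submodClosed M,
    (forall x, x \in S -> x = 0) \/ (forall x, x \in S).

Definition indecomposable M : Prop :=
  ~ zero_module M /\
  forall S T : submodClosed M,
    (forall x : M, exists2 s, s \in S & x - s \in T) ->
    (forall x : M, x \in S -> x \in T -> x = 0) ->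
    (forall x, x \in S -> x = 0) \/ (forall x, x \in T -> x = 0).

Definition in_simple_submodule M (x : M) : Prop :=
  exists2 S : submodClosed M, simple_module (submod S) & x \in S.

Definition socle_pred M : {pred M} :=
  fun x => `[< exists2 s : seq M,
                 (forall y, y \in s -> in_simple_submodule y) &
                 x = \sum_(y <- s) y >].
Arguments socle_pred : clear implicits.

Lemma socle_submod_closed M : submod_closed (socle_pred M).
Proof.
split=> [|a u v /asboolP[s sS ->] /asboolP[t tS ->]]; apply/asboolP.
  by exists [::] => //; rewrite big_nil.
exists ([seq a *: y | y <- s] ++ t); last first.
  by rewrite big_cat big_map scaler_sumr.
move=> y; rewrite mem_cat => /orP[/mapP[z /sS[S simS zS] ->]|/tS//].
by exists S => //; exact: rpredZ.
Qed.

HB.instance Definition _ M :=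
  GRing.isSubmodClosed.Build R M (socle_pred M) (socle_submod_closed M).

Definition soc M : lmodType R := submod (socle_pred M).

(* Projectivity and injectivity are those of the category of finitely generated
   modules. *)
Definition projective_module M : Prop :=
  fin_gen M /\
  forall (A B : lmodType R) (p : {linear A -> B}) (f : {linear M -> B}),
    fin_gen A -> fin_gen B -> (forall b, exists a, p a = b) ->
    exists g : {linear M -> A}, forall x, p (g x) = f x.

Definition injective_module M : Prop :=
  fin_gen M /\
  forall (A B : lmodType R) (i : {linear A -> B}) (f : {linear A -> M}),
    fin_gen A -> fin_gen B -> injective i ->
    exists g : {linear B -> M}, forall x, g (i x) = f x.

Definition exact_pair (A B C : lmodType R) (f : {linear A -> B})
    (g : {linear B -> C}) : Prop :=
  range f = [set y | g y = 0].

Definition essential_image (A B : lmodType R) (f : {linear A -> B}) : Prop :=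
  forall S : submodClosed B, (exists2 y, y \in S & y != 0) ->
    exists2 x, f x \in S & f x != 0.

Definition injective_coresolution M (I : nat -> lmodType R)
    (eta : {linear M -> I 0%N}) (d : forall j, {linear I j -> I j.+1}) : Prop :=
  [/\ forall j, injective_module (I j),
      injective eta,
      exact_pair eta (d 0%N) &
      forall j, exact_pair (d j) (d j.+1)].

Definition minimal_injective_coresolution M (I : nat -> lmodType R)
    (eta : {linear M -> I 0%N}) (d : forall j, {linear I j -> I j.+1}) : Prop :=
  [/\ injective_coresolution eta d,
      essential_image eta &
      forall j, essential_image (d j)].

(* A finite (co)resolution of length l is an infinite one that vanishes in
   degrees > l. *)
Definition has_injective_coresolution_of_length M (l : nat) : Prop :=
  exists (I : nat -> lmodType R) (eta : {linear M -> I 0%N})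
         (d : forall j, {linear I j -> I j.+1}),
    injective_coresolution eta d /\ forall j, (l < j)%N -> zero_module (I j).

Definition id_le M (m : nat) : Prop :=
  exists2 l, (l <= m)%N & has_injective_coresolution_of_length M l.

Definition id_eq M (m : nat) : Prop :=
  has_injective_coresolution_of_length M m /\
  forall l, has_injective_coresolution_of_length M l -> (m <= l)%N.

End Modules.

Section Gorenstein.
Context {L : nzRingType}.
Implicit Types M N : lmodType L.

(* Totally acyclic complexes, with cohomological indexing by the integers; the
   last condition is exactness of Hom(P, L) at Hom(P (i + 1), L). *)
Definition totally_acyclic (P : int -> lmodType L)
    (d : forall i : int, {linear P i -> P (i + 1)}) : Prop :=
  [/\ forall i, projective_module (P i),
      forall i, exact_pair (d i) (d (i + 1)) &
      forall i (f : {linear P (i + 1) -> L^o}),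
        (forall x, f (d i x) = 0) <->
        (exists g : {linear P (i + 1 + 1) -> L^o},
           forall y, f y = g (d (i + 1) y))].

Definition gorenstein_projective M : Prop :=
  exists (P : int -> lmodType L) (d : forall i : int, {linear P i -> P (i + 1)}),
    totally_acyclic d /\
    exists (i : int) (f : {linear M -> P (i + 1)}),
      injective f /\ range f = range (d i).

Definition has_gorenstein_projective_resolution_of_length N (l : nat) : Prop :=
  exists (G : nat -> lmodType L) (eps : {linear G 0%N -> N})
         (d : forall j, {linear G j.+1 -> G j}),
    [/\ forall j, gorenstein_projective (G j),
        forall y, exists x, eps x = y,
        exact_pair (d 0%N) eps,
        forall j, exact_pair (d j.+1) (d j) &
        forall j, (l < j)%N -> zero_module (G j)].

Definition Gpd_le N (m : nat) : Prop :=
  exists2 l, (l <= m)%N & has_gorenstein_projective_resolution_of_length N l.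

End Gorenstein.

Section Algebras.
Variable L : nzRingType.

Definition basic : Prop :=
  exists (r : nat) (P : 'I_r -> submodClosed (L^o : lmodType L)),
    [/\ forall x : L^o, exists! u : {ffun 'I_r -> L^o},
          (forall i, u i \in P i) /\ x = \sum_(i < r) u i,
        forall i, indecomposable (submod (P i)) &
        forall i j, i != j -> ~ isomorphic (submod (P i)) (submod (P j))].

Definition gorenstein (m : nat) : Prop :=
  id_eq (L^o : lmodType L) m /\ id_eq (L^c^o : lmodType L^c) m.

Definition domdim_set : set nat :=
  [set d | exists (I : nat -> lmodType L) (eta : {linear L^o -> I 0%N})
                  (del : forall j, {linear I j -> I j.+1}),
     minimal_injective_coresolution eta del /\
     forall j, (j < d)%N -> projective_module (I j)].

(* m <= sup domdim_set, the supremum being taken in nat + {oo} *)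
Definition le_domdim (m : nat) : Prop :=
  forall b : nat, (forall d, domdim_set d -> (d <= b)%N) -> (m <= b)%N.

Definition minimal_auslander_gorenstein (n : nat) : Prop :=
  id_le (L^o : lmodType L) n.+1 /\ le_domdim n.+1.

Definition prinj (I : lmodType L) : Prop :=
  projective_module I /\ injective_module I.

End Algebras.

Definition artin_algebra (k : comNzRingType) (L : algType k) : Prop :=
  artinian_module (k^o : lmodType k) /\ fin_gen (L : lmodType k).

(* Main.v *)
From HB Require Import structures.
Require Import Defs.
From mathcomp Require Import all_boot all_algebra.
From mathcomp Require Import boolp classical_sets.

Set Implicit Arguments.
Unset Strict Implicit.
Unset Printing Implicit Defensive.

Import GRing.Theory.
Local Open Scope ring_scope.

(** Let 0 -> L -> I_0 -> I_1 -> ... be an injective coresolution with cosyzygies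
    Z_0 = L, Z_1, ..., so that Ext^(j+1)(N, L) = Ext^1(N, Z_j).  Since L is
    (n+1)-Gorenstein, Z_(n+1) is injective, and Gpd N <= n if and only if
    Ext^1(N, Z_n) = 0, that is, every map N -> Z_(n+1) lifts to I_n.

    If J is projective and injective, a map soc J -> Z_(n+1) extends to J and then
    lifts to I_n; hence Gpd (soc J) <= n.

    Suppose I_0, ..., I_n are projective, J is injective and Gpd (soc J) <= n.
    Choose a map from N = soc J to a projective injective Q with minimal kernel K.
    By minimality Hom(K, I_j) = 0 for j <= n, so that Hom(K, Z_j) = 0 for
    j <= n + 1, and Ext^i(K, L) = 0 for all i > 0.  Then K is torsionless (dualise
    a free resolution and use the finite injective dimension of the right regular
    module), but Hom(K, L) = 0, whence K = 0.  Thus N embeds in Q, and J, being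
    an essential extension of N, is a direct summand of Q.

    Conversely, let the coresolution be minimal and I_0, ..., I_(j-1) be
    projective with j <= n.  Dimension shifting gives
    Ext^1(Z_j, Z_n) = Ext^1(L, Z_(n-j)) = 0, and this vanishing passes to the
    submodule soc I_j of Z_j because Z_(n+1) is injective; so Gpd (soc I_j) <= n
    and I_j is projective by assumption. *)

(** * Submodules, quotients and finitely generated modules *)

Section Toolkit.
Context {R : pzRingType}.
Implicit Types A B C M N : lmodType R.

Definition linear_of A B (f : A -> B) (h : linear f) : {linear A -> B} :=
  HB.pack f (GRing.isLinear.Build R A B *:%R f h).

Lemma submod_of_closed M (P : M -> Prop) :
  P 0 -> (forall a u v, P u -> P v -> P (a *: u + v)) ->
  submod_closed (fun x : M => `[< P x >]).
Proof.
by move=> P0 Plin; split=> [|a u v /asboolP Pu /asboolP Pv]; apply/asboolP;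
  [exact: P0 | exact: Plin].
Qed.

Definition submod_of M (P : M -> Prop) (P0 : P 0)
    (Plin : forall a u v, P u -> P v -> P (a *: u + v)) : submodClosed M :=
  HB.pack_for (submodClosed M) (fun x : M => `[< P x >])
    (GRing.isSubmodClosed.Build R M (fun x : M => `[< P x >])
       (submod_of_closed P0 Plin)).

Lemma submod_ofE M (P : M -> Prop) P0 Plin x :
  (x \in @submod_of M P P0 Plin) = `[< P x >].
Proof. by []. Qed.

Lemma in_submod_of M (P : M -> Prop) P0 Plin x :
  x \in @submod_of M P P0 Plin <-> P x.
Proof. by rewrite submod_ofE; split=> [/asboolP|/asboolP]. Qed.

Lemma submodB M (S : submodClosed M) x y : x \in S -> y \in S -> x - y \in S.
Proof. by move=> xS yS; rewrite -scaleN1r addrC rpredD ?rpredZ. Qed.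

Section KerIm.
Variables (A B : lmodType R) (f : {linear A -> B}).

Lemma kerS_zero : f 0 = 0. Proof. exact: linear0. Qed.
Lemma kerS_lin a u v : f u = 0 -> f v = 0 -> f (a *: u + v) = 0.
Proof. by move=> fu fv; rewrite linearP fu fv scaler0 addr0. Qed.
Definition kerS : submodClosed A := submod_of kerS_zero kerS_lin.
Lemma kerSP x : x \in kerS <-> f x = 0.
Proof. exact: in_submod_of. Qed.

Lemma imS_zero : exists x, f x = 0. Proof. by exists 0; rewrite linear0. Qed.
Lemma imS_lin a u v : (exists x, f x = u) -> (exists x, f x = v) ->
  exists x, f x = a *: u + v.
Proof. by move=> [x <-] [y <-]; exists (a *: x + y); rewrite linearP. Qed.
Definition imS : submodClosed B := submod_of imS_zero imS_lin.
Lemma imSP y : y \in imS <-> exists x, f x = y.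
Proof. exact: in_submod_of. Qed.
Lemma mem_imS x : f x \in imS.
Proof. by apply/imSP; exists x. Qed.

End KerIm.

(* Opaque, so that simplification does not unfold the inclusion. *)
Lemma incl_subproof M (S : submodClosed M) :
  {f : {linear submod S -> M} | forall x, f x = \val x}.
Proof. by exists (\val : submod S -> M). Qed.

Definition incl M (S : submodClosed M) : {linear submod S -> M} :=
  sval (incl_subproof S).
Arguments incl {M S}.

Lemma inclE M (S : submodClosed M) (x : submod S) : incl x = \val x.
Proof. exact: (svalP (incl_subproof S) x). Qed.

Lemma incl_inj M (S : submodClosed M) : injective (@incl M S).
Proof. by move=> x y; rewrite !inclE; exact: val_inj. Qed.

Lemma incl_mem M (S : submodClosed M) (x : submod S) : incl x \in S.
Proof. by rewrite inclE; exact: valP. Qed.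

Lemma inclP M (S : submodClosed M) y : y \in S -> exists x, @incl M S x = y.
Proof. by move=> yS; exists (exist _ y yS); rewrite inclE. Qed.

Lemma linear_inj A B (f : {linear A -> B}) :
  (forall x, f x = 0 -> x = 0) -> injective f.
Proof.
move=> f0 x y fxy; apply/eqP; rewrite -subr_eq0; apply/eqP/f0.
by rewrite linearB /= fxy subrr.
Qed.

Lemma inj_eq0 A B (f : {linear A -> B}) x : injective f -> f x = 0 -> x = 0.
Proof. by move=> fI fx; apply: fI; rewrite linear0. Qed.

Lemma factor_surj A B C (p : {linear A -> B}) (g : {linear A -> C}) :
  (forall b, exists a, p a = b) -> (forall a, p a = 0 -> g a = 0) ->
  exists h : {linear B -> C}, forall a, h (p a) = g a.
Proof.
move=> /choice[s ps] pg.
have hp a b : p a = p b -> g a = g b.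
  move=> pab; apply/eqP; rewrite -subr_eq0 -linearB; apply/eqP/pg.
  by rewrite linearB /= pab subrr.
have lh : linear (g \o s).
  by move=> a u v /=; rewrite -linearP; apply: hp; rewrite linearP !ps.
by exists (linear_of lh) => a /=; apply: hp.
Qed.

Lemma lift_inj A B C (i : {linear A -> B}) (f : {linear C -> B}) :
  injective i -> (forall c, exists a, i a = f c) ->
  exists g : {linear C -> A}, forall c, i (g c) = f c.
Proof.
move=> iI /choice[g ig].
have lg : linear g by move=> a u v; apply: iI; rewrite linearP !ig linearP.
by exists (linear_of lg).
Qed.

Lemma corestrict_im A B (f : {linear A -> B}) :
  exists g : {linear A -> submod (imS f)},
    (forall x, incl (g x) = f x) /\ (forall y, exists x, g x = y).
Proof.
have [g gf] := @lift_inj _ _ _ (@incl B (imS f)) f (@incl_inj _ _)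
  (fun c => inclP (mem_imS f c)).
exists g; split=> // y; have /imSP[x fx] := incl_mem y.
by exists x; apply: (@incl_inj _ (imS f)); rewrite gf.
Qed.

Definition pair_map A B C (f : {linear A -> B}) (g : {linear A -> C}) :
  {linear A -> (B * C)%type}.
Proof.
refine (@linear_of A (B * C)%type (fun x => (f x, g x)) _).
by move=> a u v; rewrite !linearP.
Defined.

Definition copair A B C (f : {linear A -> C}) (g : {linear B -> C}) :
  {linear (A * B)%type -> C}.
Proof.
refine (@linear_of (A * B)%type C (fun x => f x.1 + g x.2) _).
by move=> a u v /=; rewrite !linearP scalerDr addrACA.
Defined.

Definition lfst A B : {linear (A * B)%type -> A}.
Proof. by refine (@linear_of (A * B)%type A fst _). Defined.
Definition lsnd A B : {linear (A * B)%type -> B}.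
Proof. by refine (@linear_of (A * B)%type B snd _). Defined.

Definition surj A B (p : A -> B) := forall b, exists a, p a = b.

Definition ses A B C (i : {linear A -> B}) (p : {linear B -> C}) :=
  [/\ injective i, surj p & forall b, p b = 0 <-> exists a, i a = b].

Lemma ses_comp A B C i p (a : A) : @ses A B C i p -> p (i a) = 0.
Proof. by case=> _ _ e; apply/e; exists a. Qed.

Lemma ses_ker A B (p : {linear A -> B}) : surj p -> ses (@incl A (kerS p)) p.
Proof.
move=> ps; split=> //; first exact: incl_inj.
move=> b; split=> [pb|[a <-]]; first by apply: inclP; apply/kerSP.
by apply/kerSP; exact: incl_mem.
Qed.

Section Quotient.
Variables (M : lmodType R) (S : submodClosed M).

(** The quotient is formed as an abelian group, for which [S] is repackaged as an additive subgroup;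
    the scalar action is then defined on representatives. *)
Definition quot_zmod : zmodClosed M :=
  HB.pack_for (zmodClosed M) (fun x => x \in S)
   (GRing.isZmodClosed.Build M (fun x => x \in S)
     (conj (rpred0 S) (fun x y (xS : x \in S) (yS : y \in S) => submodB xS yS))).
Definition quotmod : Type := Quotient.quot quot_zmod.
HB.instance Definition _ := GRing.Zmodule.on quotmod.
HB.instance Definition _ := EqQuotient.on quotmod.
Local Notation pi := (\pi_quotmod)%qT.

Lemma quot_eqP x y : pi x = pi y <-> x - y \in S.
Proof. by rewrite -[_ \in S]/(x - y \in quot_zmod) Quotient.idealrBE; split=> /eqP. Qed.

Lemma quot_addE x y : pi (x + y) = pi x + pi y.
Proof. exact: Quotient.pi_add. Qed.

Definition qscale (a : R) (p : quotmod) : quotmod := pi (a *: repr p).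

Lemma pi_scale a x : qscale a (pi x) = pi (a *: x).
Proof. by apply/quot_eqP; rewrite -scalerBr rpredZ //; apply/quot_eqP; rewrite reprK. Qed.

Lemma qscaleA a b p : qscale a (qscale b p) = qscale (a * b) p.
Proof. by rewrite -[p]reprK [qscale b _]pi_scale !pi_scale scalerA. Qed.
Lemma qscale1 : left_id 1 qscale.
Proof. by move=> p; rewrite -[p]reprK pi_scale scale1r. Qed.
Lemma qscaleDr : right_distributive qscale +%R.
Proof.
move=> a p q; rewrite -[p]reprK -[q]reprK.
by rewrite -quot_addE !pi_scale scalerDr quot_addE.
Qed.
Lemma qscaleDl p : {morph qscale^~ p : a b / a + b}.
Proof. by move=> a b /=; rewrite -[p]reprK !pi_scale scalerDl quot_addE. Qed.
HB.instance Definition _ :=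
  GRing.Zmodule_isLmodule.Build R quotmod qscaleA qscale1 qscaleDr qscaleDl.

Lemma proj_linear : linear (pi : M -> quotmod).
Proof.
by move=> a u v; rewrite quot_addE -pi_scale.
Qed.
Definition quot_proj : {linear M -> quotmod} := linear_of proj_linear.

Lemma ses_quot : ses (@incl M S) quot_proj.
Proof.
split; first exact: incl_inj.
  by move=> q; exists (repr q); exact: reprK.
have pi0 : pi 0 = 0 :> quotmod := linear0 quot_proj.
move=> b; rewrite -pi0; split=> [/quot_eqP|[a <-]].
  by rewrite subr0; exact: inclP.
by apply/quot_eqP; rewrite subr0 incl_mem.
Qed.
End Quotient.

Lemma fin_gen_surj A B (p : {linear A -> B}) : surj p -> fin_gen A -> fin_gen B.
Proof.
move=> ps [r [g gP]]; exists r, (p \o g) => b; have [a <-] := ps b.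
have [c ->] := gP a; exists c; rewrite linear_sum; apply: eq_bigr => i _.
by rewrite linearZ.
Qed.

Lemma fin_gen_ext A B C (i : {linear A -> B}) (p : {linear B -> C}) :
  (forall b, p b = 0 -> exists a, i a = b) -> surj p ->
  fin_gen A -> fin_gen C -> fin_gen B.
Proof.
move=> e ps [r [g gP]] [s [h hP]].
have [h' ph] := choice ps.
exists (r + s)%N, (fun j => match split j with inl j => i (g j) | inr j => h' (h j) end).
move=> b; have [d dP] := hP (p b).
have [a ia] : exists a, i a = b - \sum_j d j *: h' (h j).
  apply: e; rewrite linearB /= linear_sum dP; apply/eqP; rewrite subr_eq0.
  by apply/eqP; apply: eq_bigr => j _; rewrite linearZ /= ph.
have [c cP] := gP a.
exists (fun j => match split j with inl j => c j | inr j => d j end).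
rewrite big_split_ord /= -[LHS](subrK (\sum_j d j *: h' (h j))) -ia cP linear_sum.
congr (_ + _); apply: eq_bigr => j _.
  by rewrite (unsplitK (inl j)) linearZ.
by rewrite (unsplitK (inr j)).
Qed.

Lemma fin_gen_prod A B : fin_gen A -> fin_gen B -> fin_gen (A * B)%type.
Proof.
apply: (@fin_gen_ext _ _ _ (pair_map (idfun : {linear A -> A}) (\0 : {linear A -> B})) (lsnd A B)).
  by move=> [a b] /= ->; exists a.
by move=> b; exists (0, b).
Qed.

Lemma fin_gen_im A B (f : {linear A -> B}) : fin_gen A -> fin_gen (submod (imS f)).
Proof. by have [g [_ gs]] := corestrict_im f; exact: fin_gen_surj gs. Qed.

Definition freemod (r : nat) : lmodType R := {ffun 'I_r -> R^o}.

Lemma lincomb_linear M r (g : 'I_r -> M) :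
  linear (fun c : freemod r => \sum_(i < r) (c i : R) *: g i).
Proof.
move=> a u v; rewrite scaler_sumr -big_split; apply: eq_bigr => i _ /=.
by rewrite !ffunE scalerDl scalerA.
Qed.

Definition lincomb M r (g : 'I_r -> M) : {linear freemod r -> M} :=
  linear_of (lincomb_linear g).

Definition free_delta r (i : 'I_r) : freemod r := [ffun j => (j == i)%:R].

Lemma lincomb_delta M r (g : 'I_r -> M) i : lincomb g (free_delta i) = g i.
Proof.
rewrite /= (bigD1 i)//= ffunE eqxx scale1r big1 ?addr0// => j /negPf ji.
by rewrite ffunE ji scale0r.
Qed.

Lemma free_decomp r (x : freemod r) : x = \sum_(i < r) (x i : R) *: free_delta i.
Proof.
apply/ffunP => j; rewrite sum_ffunE (bigD1 j)//= !ffunE eqxx.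
rewrite big1 ?addr0 => [|i /negPf ij]; first by rewrite /GRing.scale /= mulr1.
by rewrite !ffunE eq_sym ij scaler0.
Qed.

Lemma free_mapE M r (f : {linear freemod r -> M}) x :
  f x = \sum_(i < r) (x i : R) *: f (free_delta i).
Proof.
by rewrite {1}(free_decomp x) linear_sum; apply: eq_bigr => i _; rewrite linearZ.
Qed.

Lemma fin_gen_free r : fin_gen (freemod r).
Proof. by exists r, (@free_delta r) => x; exists x; exact: free_decomp. Qed.

Lemma fin_gen_cover M : fin_gen M -> exists r (p : {linear freemod r -> M}), surj p.
Proof.
move=> [r [g gP]]; exists r, (lincomb g) => x; have [c ->] := gP x.
by exists [ffun i => c i]; apply: eq_bigr => i _; rewrite ffunE.
Qed.

End Toolkit.
Arguments incl {R M S}.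

(** * Finite length over an Artin algebra *)

Section Chains.
Context {R : pzRingType}.
Implicit Types A B C M N : lmodType R.

Lemma dependent_choice (T : Type) (P : T -> Prop) (Q : T -> T -> Prop) (x0 : T) :
  P x0 -> (forall x, P x -> exists y, P y /\ Q x y) ->
  exists s : nat -> T, [/\ s 0%N = x0, forall i, P (s i) & forall i, Q (s i) (s i.+1)].
Proof.
move=> Px0 step.
have /choice[f fP] (x : {x | P x}) : exists y : {x | P x}, Q (sval x) (sval y).
  by have [y [Py Qxy]] := step _ (svalP x); exists (exist _ y Py).
exists (fun i => sval (iter i f (exist _ x0 Px0))); split=> // i.
exact: svalP.
Qed.

(** Without a minimal element, dependent choice would produce a strictly descending chain starting
    at [S0]. *)
Lemma artinian_minimal M (P : submodClosed M -> Prop) (S0 : submodClosed M) :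
  artinian_module M -> P S0 ->
  exists S : submodClosed M, P S /\
    forall T : submodClosed M, P T -> {subset T <= S} -> {subset S <= T}.
Proof.
move=> art PS0; apply: contrapT => nomin.
have [||s [_ sP sQ]] := @dependent_choice _ P
  (fun S T : submodClosed M => {subset T <= S} /\ ~ {subset S <= T}) S0.
- by [].
- move=> S PS; apply: contrapT => nT; apply: nomin; exists S; split=> // T PT TS.
  by apply: contrapT => nST; apply: nT; exists T.
- have [|m mP] := art s; first by move=> i; exact: (sQ i).1.
  by case: (sQ m) => _; apply=> x; rewrite mP.
Qed.

Lemma artinian_surj A B (p : {linear A -> B}) :
  surj p -> artinian_module A -> artinian_module B.
Proof.
move=> ps art S Sdec.
have H0 i : p 0 \in S i by rewrite linear0 rpred0.
have H1 i a u v : p u \in S i -> p v \in S i -> p (a *: u + v) \in S i.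
  by move=> pu pv; rewrite linearP rpredD ?rpredZ.
have [|m mP] := art (fun i => @submod_of _ _ (fun x => p x \in S i) (H0 i) (H1 i)).
  by move=> i x /in_submod_of/Sdec pxi; apply/in_submod_of.
exists m => i mi y; have [x <-] := ps y.
by apply/idP/idP => H; apply/(in_submod_of (H0 _) (H1 _));
   [rewrite -(mP i mi)|rewrite (mP i mi)]; apply/in_submod_of.
Qed.

Lemma artinian_inj A B (i : {linear A -> B}) :
  injective i -> artinian_module B -> artinian_module A.
Proof.
move=> iI art S Sdec.
have [|m mP] := art (fun j => imS (i \o @incl _ A (S j))).
  move=> j x /imSP[y <-]; apply/imSP => /=.
  have [z zy] := inclP (Sdec _ _ (incl_mem y)); exists z. by rewrite /= zy.
have key j x : x \in S j <-> i x \in imS (i \o @incl _ A (S j)).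
  split=> [/inclP[y <-]|/imSP[y /= /iI <-]]; last exact: incl_mem.
  by apply/imSP; exists y.
exists m => j mj x; apply/idP/idP => /key H; apply/key.
  by rewrite -(mP j mj).
by rewrite (mP j mj).
Qed.

(** The chain is stationary once its preimages in [A] and its images in [C] are: an element of a
    larger term differs from one of a smaller term by an element coming from [A]. *)
Lemma artinian_ext A B C (i : {linear A -> B}) (p : {linear B -> C}) :
  (forall b, p b = 0 -> exists a, i a = b) ->
  artinian_module A -> artinian_module C -> artinian_module B.
Proof.
move=> e artA artC S Sdec.
have H0 j : i 0 \in S j by rewrite linear0 rpred0.
have H1 j a u v : i u \in S j -> i v \in S j -> i (a *: u + v) \in S j.
  by move=> pu pv; rewrite linearP rpredD ?rpredZ.
have [|m mP] := artA (fun j => @submod_of _ _ (fun x => i x \in S j) (H0 j) (H1 j)).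
  by move=> j x /in_submod_of/Sdec pxi; apply/in_submod_of.
have [|l lP] := artC (fun j => imS (p \o @incl _ B (S j))).
  move=> j x /imSP[y <-]; apply/imSP => /=.
  by have [z zy] := inclP (Sdec _ _ (incl_mem y)); exists z; rewrite /= zy.
have Sle j j' : (j <= j')%N -> {subset S j' <= S j}.
  elim: j' => [|j' IH]; first by rewrite leqn0 => /eqP->.
  rewrite leq_eqVlt => /orP[/eqP<-//|]; rewrite ltnS => /IH jj' x /Sdec.
  exact: jj'.
exists (maxn m l) => j; rewrite geq_max => /andP[mj lj] b; apply/idP/idP.
  by apply: Sle; rewrite geq_max mj.
move=> bS.
have : p b \in imS (p \o @incl _ B (S j)).
  rewrite lP// -(lP (maxn m l)) ?leq_maxr//; apply/imSP.
  by have [b' b'E] := inclP bS; exists b'; rewrite /= b'E.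
move=> /imSP[c /= pc].
have [|a ia] := e (b - incl c); first by rewrite linearB /= pc subrr.
rewrite -(subrK (incl c) b) rpredD ?incl_mem// -ia.
apply/(in_submod_of (H0 _) (H1 _)); rewrite mP// -(mP (maxn m l)) ?leq_maxl//.
apply/in_submod_of; rewrite ia submodB//.
apply: (Sle _ j); last exact: incl_mem.
by rewrite geq_max mj.
Qed.

(** Generators are taken in the ambient module, so that minimality can be discussed among the
    submodules of one fixed [M]. *)
Definition spanned M (S : submodClosed M) : Prop :=
  exists (r : nat) (g : 'I_r -> M), (forall i, g i \in S) /\
    forall x, x \in S -> exists c : 'I_r -> R, x = \sum_(i < r) c i *: g i.

Lemma spannedP M (S : submodClosed M) : spanned S <-> fin_gen (submod S).
Proof.
split=> [[r [g [gS gP]]]|[r [g gP]]].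
  have [h hg] := choice (fun i => inclP (gS i)).
  exists r, h => x; have [c cP] := gP _ (incl_mem x); exists c.
  apply: incl_inj; rewrite cP linear_sum; apply: eq_bigr => i _.
  by rewrite linearZ /= hg.
exists r, (fun i => incl (g i)); split=> [i|x xS]; first exact: incl_mem.
have [y <-] := inclP xS; have [c ->] := gP y; exists c.
by rewrite linear_sum; apply: eq_bigr => i _; rewrite linearZ.
Qed.

End Chains.

Section Akizuki.
Variable k : comNzRingType.
Hypothesis k_art : artinian_module (k^o : lmodType k).
Implicit Types M : lmodType k.

Lemma scaling_linear M (a : k) : linear (fun x : M => a *: x).
Proof. by move=> b u v; rewrite scalerDr !scalerA mulrC. Qed.
Definition scaling M (a : k) : {linear M -> M} := linear_of (@scaling_linear M a).

(** The principal ideals of the powers of [a] form a descending chain. *)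
Lemma pow_stable (a : k) : exists m b, a ^+ m = a ^+ m.+1 * b.
Proof.
have [|m mP] := @k_art (fun i => imS (scaling k^o (a ^+ i))).
  by move=> i x /imSP[y <-]; apply/imSP; exists (a * y); rewrite /= exprSr -scalerA.
have : (a ^+ m : k^o) \in imS (scaling k^o (a ^+ m)).
  by apply/imSP; exists 1; rewrite /= /GRing.scale /= mulr1.
by rewrite -(mP m.+1)// => /imSP[b E]; exists m, b; rewrite -[LHS]E.
Qed.

(* A submodule that is minimal among the non finitely generated ones is a vector
   space over the field k / ann; an independent sequence in it then spans a
   strictly decreasing chain. *)
Lemma artinian_spanned M (S : submodClosed M) : artinian_module M -> spanned S.
Proof.
move=> art; apply: contrapT => nS.
have [N [nN Nmin]] := artinian_minimal (P := fun S => ~ spanned S) art nS.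
have N_eq (T : submodClosed M) : {subset T <= N} -> ~ spanned T -> {subset N <= T}.
  by move=> TN nT; exact: Nmin.
pose aN a := imS (scaling M a \o @incl _ M N).
pose kN a := imS (@incl _ M N \o @incl _ _ (kerS (scaling M a \o @incl _ M N))).
have aNsub a : {subset aN a <= N}.
  by move=> x /imSP[y <-] /=; rewrite rpredZ ?incl_mem.
have kNsub a : {subset kN a <= N} by move=> x /imSP[y <-] /=; exact: incl_mem.
(* A proper submodule of [N] is spanned, by minimality. If [aN a] is proper, then the kernel [kN a]
   of multiplication by [a] cannot be spanned too, [N] being an extension of the one by the other;
   so this kernel is all of [N]. *)
have dich a : {subset N <= aN a} \/ forall x, x \in N -> a *: x = 0.
  have [fa|] := pselect (spanned (aN a)); last by move=> /(N_eq _ (aNsub a)); left.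
  have [fk|] := pselect (spanned (kN a)); last first.
    move=> /(N_eq _ (kNsub a)) h; right=> x /h/imSP[y <-] /=.
    exact: (kerSP _ _).1 (incl_mem y).
  case: nN; apply/spannedP.
  have /spannedP fga := fa; have /spannedP fgk := fk.
  have [g [ga gs]] := corestrict_im (scaling M a \o @incl _ M N).
  have [h hk] := @lift_inj _ _ _ _ (@incl _ M N) (@incl _ M (kN a)) (@incl_inj _ _ _)
    (fun c => inclP (kNsub _ _ (incl_mem c))).
  apply: (fin_gen_ext (i := h) (p := g)) => // b gb.
  have bk : incl b \in kN a.
    have [c cb] := inclP ((kerSP (scaling M a \o @incl _ M N) b).2
      (etrans (esym (ga b)) (etrans (congr1 incl gb) (linear0 _)))).
    by apply/imSP; exists c; rewrite /= cb.
  by have [c cb] := inclP bk; exists c; apply: incl_inj; rewrite hk.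
(* Every element of [N] is a multiple of [a ^+ m], so the relation [a ^+ m = a ^+ m.+1 * b] makes
   [b] an inverse of [a] on [N]. *)
have inv a : {subset N <= aN a} -> exists b, forall x, x \in N -> b *: (a *: x) = x.
  move=> Na; have [m [b mb]] := pow_stable a; exists b.
  have Nam j x : x \in N -> exists2 y, y \in N & x = a ^+ j *: y.
    elim: j x => [|j IH] x xN; first by exists x; rewrite ?expr0 ?scale1r.
    have [y yN ->] := IH _ xN; have /imSP[z <-] := Na _ yN.
    by exists (incl z); [exact: incl_mem | rewrite /= scalerA exprSr].
  by move=> x /(Nam m)[y yN ->]; rewrite !scalerA -mulrA -exprS mulrC -mb.
have next (s : seq M) : (forall x, x \in s -> x \in N) ->
    exists y, y \in N /\ ~ exists c : 'I_(size s) -> k,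
      y = \sum_(i < size s) c i *: s`_i.
  move=> sN; apply: contrapT => none; apply: nN.
  exists (size s), (fun i => s`_i); split=> [i|x xN].
    by apply: sN; rewrite mem_nth.
  by apply: contrapT => nc; apply: none; exists x.
have [||s [s0 sN sQ]] := @dependent_choice (seq M)
   (fun s => forall x, x \in s -> x \in N)
   (fun s t => exists y, t = rcons s y /\ ~ exists c : 'I_(size s) -> k,
      y = \sum_(i < size s) c i *: s`_i) [::].
- by [].
- move=> s sN; have [y [yN yP]] := next _ sN; exists (rcons s y).
  split; last by exists y.
  by move=> x; rewrite mem_rcons inE => /orP[/eqP->|/sN].
have ssz i : size (s i) = i.
  elim: i => [|i IH]; first by rewrite s0.
  by have [y [-> _]] := sQ i; rewrite size_rcons IH.
pose x i := (s i.+1)`_i.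
have sx i j : (j < i)%N -> (s i)`_j = x j.
  elim: i => [//|i IH]; rewrite ltnS leq_eqVlt => /orP[/eqP->//|ji].
  by have [y [-> _]] := sQ i; rewrite nth_rcons ssz ji IH.
have xN i : x i \in N by apply: (sN i.+1); rewrite mem_nth// ssz.
have xP i : ~ exists c : nat -> k, x i = \sum_(j < i) c j *: x j.
  move=> [c xc]; have [y [yE]] := sQ i; case; exists (fun j => c j).
  have -> : y = x i by rewrite /x yE nth_rcons ssz ltnn eqxx.
  rewrite xc; have E := ssz i; rewrite -[in LHS]E; apply: eq_bigr => j _.
  by rewrite sx// -[X in (_ < X)%N]E.
have dep m p (c : nat -> k) : \sum_(j < m + p) c j *: x j = 0 ->
   (forall j, (j < m)%N -> c j = 0) -> ~ c m *: x m = x m \/ p = 0%N.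
  elim: p => [|p IH]; first by right.
  rewrite addnS big_ord_recr /= => sum0 cm; left.
  case: (dich (c (m + p)%N)) => [/inv[b bP]|c0].
    move=> _; apply: (xP (m + p)%N); exists (fun j => - b * c j).
    under eq_bigr do rewrite -scalerA.
    rewrite -scaler_sumr; move/eqP: sum0; rewrite addr_eq0 => /eqP->.
    by rewrite scaleNr scalerN opprK bP.
  move: sum0; rewrite c0// addr0 => /IH/(_ cm)[//|p0].
  move=> cxm; apply: (xP m); exists (fun=> 0).
  by rewrite -cxm -[X in c X](addn0 m) -p0 c0// big1// => i _; rewrite scale0r.
(* The span of the [x j] with [m <= j], written through coefficients that vanish below [m]. *)
pose tail m (u : M) := exists (p : nat) (c : nat -> k),
  (forall j, (j < m)%N -> c j = 0) /\ u = \sum_(j < p) c j *: x j.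
have V0 m : tail m 0 by exists 0%N, (fun=> 0); rewrite big_ord0.
have Vlin m a u v : tail m u -> tail m v -> tail m (a *: u + v).
  move=> [p [c [cm ->]]] [q [d [dm ->]]].
  pose c' j := if (j < p)%N then c j else 0; pose d' j := if (j < q)%N then d j else 0.
  exists (p + q)%N, (fun j => a * c' j + d' j); split.
    by move=> j jm; rewrite /c' /d' cm// dm// !if_same mulr0 addr0.
  under [RHS]eq_bigr do rewrite scalerDl -scalerA.
  rewrite big_split /= -scaler_sumr; congr (_ *: _ + _).
    rewrite big_split_ord /= [X in _ = _ + X]big1 ?addr0.
      by apply: eq_bigr => i _; rewrite /c' ltn_ord.
    by move=> i _; rewrite /c' ltnNge leq_addr scale0r.
  rewrite addnC big_split_ord /= [X in _ = _ + X]big1 ?addr0.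
    by apply: eq_bigr => i _; rewrite /d' ltn_ord.
  by move=> i _; rewrite /d' ltnNge leq_addr scale0r.
pose V m := submod_of (V0 m) (Vlin m).
have [|m mP] := art V.
  move=> i y /in_submod_of[p [c [cm ->]]]; apply/in_submod_of; exists p, c; split=> // j ji.
  by apply: cm; exact: ltnW.
have : x m \in V m.
  apply/in_submod_of; exists m.+1, (fun j => (j == m)%:R); split.
    by move=> j jm; rewrite (ltn_eqF jm).
  rewrite big_ord_recr /= eqxx scale1r big1 ?add0r// => i _.
  by rewrite (ltn_eqF (ltn_ord i)) scale0r.
rewrite -(mP m.+1)// => /in_submod_of[p [c [cm xm]]].
pose c' j := if (j < p)%N then c j else 0.
have c'm j : (j < m.+1)%N -> c' j = 0 by move=> jm; rewrite /c' cm// if_same.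
(* If [x m] lay in [V m.+1], the difference of its two expressions would be a relation with
   coefficient 1 at [m]; the bound [m + p.+1] makes room for the index [m]. *)
have := dep m p.+1 (fun j => (j == m)%:R - c' j); case=> [||h|//].
- under eq_bigr do rewrite scalerBl.
  have lm : (m < m + p.+1)%N by rewrite addnS ltnS leq_addr.
  rewrite sumrB (bigD1 (Ordinal lm)) //= eqxx scale1r big1 ?addr0; last first.
    move=> i im; suff -> : (i == m :> nat) = false by rewrite scale0r.
    by apply: contraNF im => /eqP im; apply/eqP/val_inj.
  rewrite {1}xm addnS -addSn addnC big_split_ord /= [X in _ - (_ + X)]big1; last first.
    by move=> i _; rewrite /c' ltnNge leq_addr scale0r.
  by rewrite addr0; apply/eqP; rewrite subr_eq0; apply/eqP/eq_bigr => i _; rewrite /c' ltn_ord.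
- by move=> j jm; rewrite (ltn_eqF jm) c'm ?subr0// ltnW.
- by apply: h; rewrite eqxx c'm// subr0 scale1r.
Qed.

(** Induction on the number of generators: [M] is a quotient of the product of [k] with the
    submodule generated by all but the last generator. *)
Lemma fin_gen_artinian M : fin_gen M -> artinian_module M.
Proof.
move=> [r [g gP]].
elim: r M g gP => [|r IH] M g gP.
  move=> S _; exists 0%N => i _ x; have [c ->] := gP x.
  by rewrite big_ord0 !rpred0.
pose f := lincomb (fun i => g (widen_ord (leqnSn r) i)).
have fg := corestrict_im f; move: fg => [f' [f'f f's]].
have artN : artinian_module (submod (imS f)).
  pose e i := f' (free_delta i).
  apply: (IH _ e) => y; have [c <-] := f's y; exists c; apply: incl_inj.
  rewrite f'f linear_sum /=; apply: eq_bigr => i _; rewrite linearZ /= f'f.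
  by rewrite lincomb_delta.
apply: (artinian_surj (p := copair (@incl _ M (imS f)) (lincomb (fun _ : 'I_1 => g ord_max)))).
  move=> x; have [c ->] := gP x.
  have [y yE] := inclP (mem_imS f [ffun i => c (widen_ord (leqnSn r) i)]).
  exists (y, [ffun=> c ord_max]); rewrite /= yE /= [RHS]big_ord_recr /= big_ord1 ffunE.
  by congr (_ + _); apply: eq_bigr => i _; rewrite ffunE.
apply: (artinian_ext (p := lsnd _ _)
  (i := pair_map (idfun : {linear submod (imS f) -> submod (imS f)})
          (\0 : {linear _ -> freemod 1}))) => //.
  by move=> [y b] /= ->; exists y.
have ev_lin : linear (fun c : freemod 1 => c ord0 : k^o).
  by move=> a u v; rewrite !ffunE.
apply: (artinian_inj (i := linear_of ev_lin)) => //.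
by move=> u v /= uv; apply/ffunP => i; rewrite (ord1 i).
Qed.

End Akizuki.

(** * Chain conditions for a ring that is finite over an artinian commutative ring *)

Definition fg_noetherian (R : pzRingType) : Prop :=
  forall M : lmodType R, fin_gen M ->
  forall S : submodClosed M, fin_gen (submod S).

Definition fg_artinian (R : pzRingType) : Prop :=
  forall M : lmodType R, fin_gen M -> artinian_module M.

Lemma fin_gen_fin (R : pzRingType) (M : lmodType R) (T : finType) (g : T -> M) :
  (forall x, exists c : T -> R, x = \sum_t c t *: g t) -> fin_gen M.
Proof.
move=> gP; exists #|T|, (g \o enum_val) => x; have [c ->] := gP x.
exists (c \o enum_val).
rewrite -(big_enum_val (A := T) (fun t => c t *: g t)) /=.
by apply: eq_bigl => t; rewrite inE.
Qed.

Section Restriction.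
Variables (k : comNzRingType) (R : pzRingType) (phi : {rmorphism k -> R}).

(** A synonym of [M] that carries the action of [k] through [phi]. A ring morphism is used as data
    so that one argument serves both [L] and [L^c]. *)
Definition restrict_scalars (M : lmodType R) : Type := M.
HB.instance Definition _ (M : lmodType R) := GRing.Zmodule.on (restrict_scalars M).

Section Instance.
Variable M : lmodType R.
Definition restr_scale (a : k) (x : restrict_scalars M) : restrict_scalars M := phi a *: (x : M).
Lemma restr_scaleA a b x : restr_scale a (restr_scale b x) = restr_scale (a * b) x.
Proof. by rewrite /restr_scale scalerA rmorphM. Qed.
Lemma restr_scale1 : left_id 1 restr_scale.
Proof. by move=> x; rewrite /restr_scale rmorph1 scale1r. Qed.
Lemma restr_scaleDr : right_distributive restr_scale +%R.
Proof. by move=> a x y; rewrite /restr_scale scalerDr. Qed.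
Lemma restr_scaleDl x : {morph restr_scale^~ x : a b / a + b}.
Proof. by move=> a b; rewrite /restr_scale rmorphD scalerDl. Qed.
HB.instance Definition _ := GRing.Zmodule_isLmodule.Build k (restrict_scalars M)
  restr_scaleA restr_scale1 restr_scaleDr restr_scaleDl.
End Instance.

Variables (r0 : nat) (g0 : 'I_r0 -> R).
Hypothesis g0P : forall x, exists c : 'I_r0 -> k, x = \sum_(i < r0) phi (c i) * g0 i.
Hypothesis k_art : artinian_module (k^o : lmodType k).

Lemma fin_gen_restr (M : lmodType R) : fin_gen M -> fin_gen (restrict_scalars M : lmodType k).
Proof.
move=> [r [g gP]].
apply: (@fin_gen_fin _ _ ('I_r * 'I_r0)%type (fun p => (g0 p.2 *: g p.1 : M) : restrict_scalars M)) => x.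
have [c xc] := gP x; have [d dP] := choice (fun i => g0P (c i)).
exists (fun p => d p.1 p.2).
rewrite [LHS]xc -(pair_bigA _ (fun i j => d i j *: ((g0 j *: g i : M) : restrict_scalars M))).
apply: eq_bigr => i _; rewrite [in LHS]dP scaler_suml; apply: eq_bigr => j _.
by rewrite -scalerA.
Qed.

Lemma fg_artinian_of_finite : fg_artinian R.
Proof.
move=> M fgM S Sdec.
have lin i a (u v : restrict_scalars M) : u \in S i -> v \in S i -> a *: u + v \in S i.
  move=> uS vS; apply: (rpredD (_ : phi a *: (u : M) \in S i) vS).
  exact: rpredZ.
have [|m mP] := fin_gen_artinian k_art (fin_gen_restr fgM)
  (S := fun i => @submod_of _ (restrict_scalars M : lmodType k) (fun x => x \in S i) (rpred0 _) (lin i)).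
  by move=> i x /in_submod_of/Sdec xS; apply/in_submod_of.
exists m => i mi x; have := mP i mi x; rewrite !submod_ofE.
by rewrite !asboolb.
Qed.

(** An [R]-submodule is a [k]-submodule of an artinian [k]-module, hence spanned over [k], and
    generators over [k] generate over [R]. *)
Lemma fg_noetherian_of_finite : fg_noetherian R.
Proof.
move=> M fgM S; apply/spannedP.
have lin a (u v : restrict_scalars M) : u \in S -> v \in S -> a *: u + v \in S.
  move=> uS vS; apply: (rpredD (_ : phi a *: (u : M) \in S) vS).
  exact: rpredZ.
have [r [g [gS gP]]] := artinian_spanned k_art
  (@submod_of _ (restrict_scalars M : lmodType k) (fun x => x \in S) (rpred0 _) lin)
  (fin_gen_artinian k_art (fin_gen_restr fgM)).
exists r, g; split=> [i|x xS]; first by have /in_submod_of := gS i.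
have [|c cP] := gP x; first exact/in_submod_of.
by exists (fun i => phi (c i)).
Qed.

End Restriction.

Section ArtinAlgebra.
Variables (k : comNzRingType) (L : algType k) (L_artin : artin_algebra L).

Definition converse_alg_fun (a : k) : L^c := (a%:A : L).
Lemma converse_alg_zmod : zmod_morphism converse_alg_fun.
Proof. by move=> a b; rewrite /converse_alg_fun scalerBl. Qed.
Lemma converse_alg_monoid : monoid_morphism converse_alg_fun.
Proof.
rewrite /converse_alg_fun; split=> [|a b]; first by rewrite scale1r.
by rewrite /GRing.mul /= -/(GRing.mul _ _) -scalerAl mul1r scalerA mulrC.
Qed.
HB.instance Definition _ := GRing.isZmodMorphism.Build k L^c
  converse_alg_fun converse_alg_zmod.
HB.instance Definition _ := GRing.isMonoidMorphism.Build k L^c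
  converse_alg_fun converse_alg_monoid.
Definition converse_alg : {rmorphism k -> L^c} := converse_alg_fun.

(** The scalars of [k] are central, so the same generators serve on both sides. *)
Lemma artin_algebra_gens : exists r (g : 'I_r -> L),
  (forall x : L, exists c : 'I_r -> k, x = \sum_(i < r) in_alg L (c i) * g i) /\
  (forall x : L^c, exists c : 'I_r -> k,
     x = \sum_(i < r) converse_alg (c i) * (g i : L^c)).
Proof.
have [r [g gP]] := L_artin.2; exists r, g; split=> x.
  have [c ->] := gP x; exists c; apply: eq_bigr => i _.
  by rewrite -[in LHS](mul1r (g i)) scalerAl.
have [c cP] := gP x; exists c; rewrite [LHS]cP; apply: eq_bigr => i _.
by rewrite -[in LHS](mulr1 (g i)) scalerAr.
Qed.

Lemma artin_algebra_artinian : fg_artinian L.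
Proof.
have [r [g [gP _]]] := artin_algebra_gens.
exact: (fg_artinian_of_finite gP L_artin.1).
Qed.

Lemma artin_algebra_noetherian : fg_noetherian L.
Proof.
have [r [g [gP _]]] := artin_algebra_gens.
exact: (fg_noetherian_of_finite gP L_artin.1).
Qed.

Lemma artin_algebra_converse_noetherian : fg_noetherian L^c.
Proof.
have [r [g [_ gP]]] := artin_algebra_gens.
exact: (fg_noetherian_of_finite gP L_artin.1).
Qed.

End ArtinAlgebra.

(** * Vanishing of Ext^1 and dimension shifting *)

Section Ext.
Context {R : pzRingType}.
Implicit Types A B C E G M N P X : lmodType R.

Lemma free_lift A B r (q : {linear A -> B}) (f : {linear freemod r -> B}) :
  surj q -> exists g : {linear freemod r -> A}, forall x, q (g x) = f x.
Proof.
move=> /choice[s qs]; exists (lincomb (fun i => s (f (free_delta i)))) => x.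
rewrite [RHS]free_mapE /= linear_sum; apply: eq_bigr => i _.
by rewrite linearZ /= qs.
Qed.

Lemma free_projective r : projective_module (freemod (R := R) r).
Proof.
split; first exact: fin_gen_free.
by move=> A B q f _ _; exact: free_lift.
Qed.

Lemma projective_lift P A B (q : {linear A -> B}) (f : {linear P -> B}) :
  projective_module P -> fin_gen A -> surj q ->
  exists g : {linear P -> A}, forall x, q (g x) = f x.
Proof. by move=> [_ Pp] fA qs; apply: Pp => //; exact: fin_gen_surj fA. Qed.

(* Vanishing of Ext^1(N, X), stated without choosing a resolution: every pushout
   along a map A -> X of an extension of N by A splits. *)
Definition ext1z N X : Prop :=
  forall A B (i : {linear A -> B}) (p : {linear B -> N}),
    fin_gen A -> fin_gen B -> ses i p ->
    forall f : {linear A -> X}, exists g : {linear B -> X}, forall a, g (i a) = f a.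

Lemma ses_factor A B C X (i : {linear A -> B}) (p : {linear B -> C})
    (g : {linear B -> X}) : ses i p -> (forall a, g (i a) = 0) ->
  exists h : {linear C -> X}, forall b, h (p b) = g b.
Proof.
move=> [_ ps e] gi; apply: factor_surj => // b /e[a <-]; exact: gi.
Qed.

Lemma ses_lift A B C M (i : {linear A -> B}) (p : {linear B -> C})
    (g : {linear M -> B}) : ses i p -> (forall m, p (g m) = 0) ->
  exists h : {linear M -> A}, forall m, i (h m) = g m.
Proof.
by move=> [iI _ e] pg; apply: lift_inj => // m; apply/e; exact: pg.
Qed.

Lemma ext1z_injective N X : injective_module X -> ext1z N X.
Proof. by move=> [_ Xi] A B i p fA fB [iI _ _] f; exact: Xi. Qed.

Lemma ext1z_projective N X : projective_module N -> ext1z N X.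
Proof.
move=> Np A B i p fA fB s f.
have [t pt] := projective_lift (idfun : {linear N -> N}) Np fB (let: And3 _ h _ := s in h).
have [|rho rhoP] := ses_lift (g := idfun \- (t \o p)) s.
  by move=> b; rewrite /= linearB /= pt subrr.
exists (f \o rho) => a /=; congr (f _); case: (s) => iI _ _; apply: iI.
by rewrite rhoP /= (ses_comp a s) linear0 subr0.
Qed.

(** [Ext^1(N, X)] is the cokernel of [Hom(N, E) -> Hom(N, X')]. Concretely, [f] extends to a map [g]
    into [E], which induces [u] on [N]; subtracting a lift of [u] brings [g] into [X]. *)
Lemma ext1z_of_lift N X E X' (j : {linear X -> E}) (q : {linear E -> X'}) :
  ses j q -> injective_module E ->
  (forall u : {linear N -> X'}, exists v : {linear N -> E}, forall x, q (v x) = u x) ->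
  ext1z N X.
Proof.
move=> sX [_ Ei] H A B i p fA fB s f.
have iI : injective i by case: s.
have [g gi] := Ei _ _ i (j \o f) fA fB iI.
have [|u up] := ses_factor (g := q \o g) s.
  by move=> a; rewrite /= gi /= (ses_comp _ sX).
have [v qv] := H u.
have [|h hP] := ses_lift (g := g \- (v \o p)) sX.
  by move=> b; rewrite /= linearB /= qv up /= subrr.
exists h => a; case: (sX) => jI _ _; apply: jI.
by rewrite hP /= gi (ses_comp a s) linear0 subr0.
Qed.

Lemma ext1z_iso N N' X (e : {linear N' -> N}) :
  injective e -> surj e -> ext1z N X -> ext1z N' X.
Proof.
move=> eI es H A B i p fA fB [iI ps ex] f.
apply: (H _ _ i (e \o p)) => //; split=> //.
  by move=> x; have [y <-] := es x; have [b <-] := ps y; exists b.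
move=> b; split=> [/= /(inj_eq0 eI)/ex//|/ex pb /=].
by rewrite pb linear0.
Qed.

Lemma bijective_inverse N N' (e : {linear N' -> N}) :
  injective e -> surj e -> exists e' : {linear N -> N'}, injective e' /\ surj e'.
Proof.
move=> eI es.
have [e' e'P] := lift_inj (f := (idfun : {linear N -> N})) eI es.
exists e'; split=> [x y xy|x]; first by rewrite -[x]e'P -[y]e'P xy.
by exists (e x); apply: eI; rewrite e'P.
Qed.

Section Pullback.
Variables (B G N : lmodType R) (p : {linear B -> N}) (q : {linear G -> N}).

Definition pullback_diff : {linear (B * G)%type -> N} :=
  (p \o lfst B G) \- (q \o lsnd B G).
Definition pullback : lmodType R := submod (kerS pullback_diff).
Definition pullback_fst : {linear pullback -> B} := lfst B G \o incl.
Definition pullback_snd : {linear pullback -> G} := lsnd B G \o incl.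

Lemma pullbackE x : p (pullback_fst x) = q (pullback_snd x).
Proof. by have /kerSP/eqP := incl_mem x; rewrite subr_eq0 => /eqP. Qed.

Lemma pullback_exists b g : p b = q g -> exists x, pullback_fst x = b /\ pullback_snd x = g.
Proof.
move=> pq; have [|x xE] := @inclP _ _ (kerS pullback_diff) (b, g).
  by apply/kerSP; rewrite /= pq subrr.
by exists x; rewrite /pullback_fst /pullback_snd /= xE.
Qed.

Lemma pullback_eq x y : pullback_fst x = pullback_fst y -> pullback_snd x = pullback_snd y -> x = y.
Proof.
move=> e1 e2; apply: incl_inj; rewrite [LHS]surjective_pairing.
by rewrite [RHS]surjective_pairing; congr (_, _).
Qed.

(** Pulling an extension of [N] back along [q] gives an extension of [G] with the same kernel,
    included by [(i, 0)]. *)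
Lemma pullback_snd_ses A (i : {linear A -> B}) : ses i p -> surj q ->
  exists j : {linear A -> pullback}, ses j pullback_snd /\ forall a, pullback_fst (j a) = i a.
Proof.
move=> s qs; case: (s) => iI ps e.
have [j jP] := @lift_inj _ _ _ _ (@incl _ _ (kerS pullback_diff))
   (pair_map i (\0 : {linear A -> G})) (@incl_inj _ _ _)
   (fun a => inclP ((kerSP pullback_diff (i a, 0)).2
      (etrans (congr2 (fun x y => x - y) (ses_comp a s) (linear0 q)) (subrr _)))).
have j1 a : pullback_fst (j a) = i a by rewrite /pullback_fst /= jP.
have j2 a : pullback_snd (j a) = 0 by rewrite /pullback_snd /= jP.
exists j; split=> //; split.
- by move=> a b ab; apply: iI; rewrite -!j1 ab.
- move=> g; have [b pb] := ps (q g).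
  by have [x [_ <-]] := pullback_exists pb; exists x.
- move=> x; split=> [x2|[a <-]]; last exact: j2.
  have [|a ax] := (e (pullback_fst x)).1; first by rewrite pullbackE x2 linear0.
  by exists a; apply: pullback_eq; rewrite ?j1 ?j2.
Qed.

End Pullback.

Lemma pullback_fst_ses (B G N : lmodType R) (p : {linear B -> N}) (q : {linear G -> N}) A'
   (i : {linear A' -> G}) : ses i q -> surj p ->
  exists j : {linear A' -> pullback p q}, ses j (pullback_fst p q) /\ forall a, pullback_snd p q (j a) = i a.
Proof.
move=> s ps; case: (s) => iI qs e.
have [j jP] := @lift_inj _ _ _ _ (@incl _ _ (kerS (pullback_diff p q)))
   (pair_map (\0 : {linear A' -> B}) i) (@incl_inj _ _ _)
   (fun a => inclP ((kerSP (pullback_diff p q) (0, i a)).2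
      (etrans (congr2 (fun x y => x - y) (linear0 p) (ses_comp a s)) (subrr _)))).
have j1 a : pullback_fst p q (j a) = 0 by rewrite /pullback_fst /= jP.
have j2 a : pullback_snd p q (j a) = i a by rewrite /pullback_snd /= jP.
exists j; split=> //; split.
- by move=> a b ab; apply: iI; rewrite -!j2 ab.
- move=> b; have [g qg] := qs (p b).
  by have [x [<- _]] := pullback_exists (esym qg); exists x.
- move=> x; split=> [x1|[a <-]]; last exact: j1.
  have [|a ax] := (e (pullback_snd p q x)).1; first by rewrite -pullbackE x1 linear0.
  by exists a; apply: pullback_eq; rewrite ?j1 ?j2.
Qed.

(* The part Hom(G, X) -> Hom(N', X) -> Ext^1(N, X) -> Ext^1(G, X) of the long
   exact sequence. *)
Lemma ext1z_of_pres N' G N X (i : {linear N' -> G}) (q : {linear G -> N}) :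
  ses i q -> fin_gen G -> ext1z G X ->
  (forall f : {linear N' -> X}, exists g : {linear G -> X}, forall a, g (i a) = f a) ->
  ext1z N X.
Proof.
move=> s fG GX H A B iA p fA fB sA f.
have [iAI ps eA] := sA; have [iI qs e] := s.
have [j [sj j1]] := pullback_snd_ses sA qs.
have [j' [sj' j'2]] := pullback_fst_ses s ps.
have fQ : fin_gen (pullback p q).
  by case: sj => _ sj1 sj2; apply: (fin_gen_ext (i := j) _ sj1) => // b /sj2.
(* [h] extends [f] to the pullback, an extension of [G]. Once corrected by a map from [G] that
   agrees with it on [N'], it descends to [B]. *)
have [h hj] := GX _ _ j (pullback_snd p q) fA fQ sj f.
have [w wi] := H (h \o j').
have [|g gP] := ses_factor (g := h \- (w \o pullback_snd p q)) sj'.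
  by move=> a; move: (j'2 a) => /= ->; rewrite wi /= subrr.
exists g => a; rewrite -j1 gP /= hj; move: (ses_comp a sj) => /= ->.
by rewrite linear0 subr0.
Qed.

Hypothesis noeth : fg_noetherian R.

(** Converse of [ext1z_of_lift]. A free cover of [N] maps to [E] over [u], and its kernel then maps
    to [X]; this map extends to the free module because [Ext^1(N, X)] vanishes, and subtracting the
    extension gives a lift on [N]. *)
Lemma ext1z_lift N X E X' (j : {linear X -> E}) (q : {linear E -> X'}) :
  fin_gen N -> ses j q -> ext1z N X ->
  forall u : {linear N -> X'}, exists v : {linear N -> E}, forall x, q (v x) = u x.
Proof.
move=> fN sX H u; have [r [p ps]] := fin_gen_cover fN.
have sp := ses_ker ps.
have [|g qg] := free_lift (u \o p) (q := q); first by case: sX.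
have [|f fP] := ses_lift (g := g \o incl (S := kerS p)) sX.
  by move=> b; rewrite /= qg /= (ses_comp b sp) linear0.
have [w wP] := H _ _ _ _ (noeth (fin_gen_free r) _) (fin_gen_free r) sp f.
have [|v vP] := ses_factor (g := g \- (j \o w)) sp.
  by move=> b; rewrite /= wP fP /= subrr.
exists v => x; have [y <-] := ps x.
by rewrite vP /= linearB /= (ses_comp _ sX) subr0 qg.
Qed.

Lemma fin_gen_inj A B (i : {linear A -> B}) : injective i -> fin_gen B -> fin_gen A.
Proof.
move=> iI fB; have [g [gi gs]] := corestrict_im i.
have gI : injective g by move=> x y gxy; apply: iI; rewrite -!gi gxy.
have [h [_ hs]] := bijective_inverse gI gs.
exact: (fin_gen_surj hs (noeth fB _)).
Qed.

(** A map from [N'] to [X'] lifts to [E] since [Ext^1(N', X) = 0], and then extends to [G] since [E]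
    is injective; so [Ext^1(N, X')] embeds in [Ext^1(G, X')]. *)
Lemma ext1z_shift_up N' G N X E X' (i : {linear N' -> G}) (p : {linear G -> N})
    (j : {linear X -> E}) (q : {linear E -> X'}) :
  ses i p -> ses j q -> fin_gen G -> injective_module E ->
  ext1z N' X -> ext1z G X' -> ext1z N X'.
Proof.
move=> sN sX fG Ei NX GX; apply: (ext1z_of_pres sN) => // u.
have iI : injective i by case: sN.
have fN' := fin_gen_inj iI fG.
have [v qv] := ext1z_lift fN' sX NX u.
case: Ei => _ Ei; have [w wi] := Ei _ _ i v fN' fG iI.
by exists (q \o w) => a; rewrite /= wi qv.
Qed.

(** [Ext^1(N', X) = Ext^2(N, X) = Ext^1(N, X')]: a map from [N'] to [X'] extends to [P], and the
    extension lifts to [E]. *)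
Lemma ext1z_shift_down N' P N X E X' (i : {linear N' -> P}) (p : {linear P -> N})
    (j : {linear X -> E}) (q : {linear E -> X'}) :
  ses i p -> ses j q -> projective_module P -> injective_module E ->
  ext1z N X' -> ext1z N' X.
Proof.
move=> sN sX Pp Ei NX; apply: (ext1z_of_lift sX Ei) => u.
have [iI _ _] := sN; have [_ qs _] := sX.
have [v vi] := NX _ _ i p (fin_gen_inj iI Pp.1) Pp.1 sN u.
have [w qw] := projective_lift v Pp Ei.1 qs.
by exists (w \o i) => x; rewrite /= qw vi.
Qed.

(** The coresolution has length one, so [Ext^1(-, X)] is right exact: a map from [N0] to [X'] first
    extends to [N] and then lifts. *)
Lemma ext1z_sub N0 N X E X' (i : {linear N0 -> N})
    (j : {linear X -> E}) (q : {linear E -> X'}) :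
  injective i -> fin_gen N -> ses j q -> injective_module E -> injective_module X' ->
  ext1z N X -> ext1z N0 X.
Proof.
move=> iI fN sX Ei [_ X'i] NX; apply: (ext1z_of_lift sX Ei) => u.
have [v vi] := X'i _ _ i u (fin_gen_inj iI fN) fN iI.
have [w qw] := ext1z_lift fN sX NX v.
by exists (w \o i) => x; rewrite /= qw vi.
Qed.

Lemma injective_of_ext1z X :
  fin_gen X -> (forall N, fin_gen N -> ext1z N X) -> injective_module X.
Proof.
move=> fX H; split=> // A B i f fA fB iI.
have [g [gi gs]] := corestrict_im i.
have gI : injective g by move=> x y gxy; apply: iI; rewrite -!gi gxy.
have [h hg] := factor_surj (p := g) (g := f) gs (fun a ga =>
  etrans (congr1 f (inj_eq0 gI ga)) (linear0 f)).
have s := ses_quot (imS i).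
have [_ ps _] := s.
have [w wP] := H _ (fin_gen_surj ps fB) _ _ _ _ (noeth fB _) fB s h.
by exists w => a; rewrite -gi wP hg.
Qed.

Definition cosyzygies (Z I : nat -> lmodType R) (i : forall j, {linear Z j -> I j})
    (p : forall j, {linear I j -> Z j.+1}) : Prop :=
  forall j, injective_module (I j) /\ ses (i j) (p j).

Lemma cosyz_fin_gen Z I i p j : @cosyzygies Z I i p -> fin_gen (Z j).
Proof. by move=> cz; have [[fI _] [iI _ _]] := cz j; exact: fin_gen_inj iI fI. Qed.

(** Vanishing of [Ext^1(-, Z j)], which is [Ext^(j+1)(-, Z 0)], depends only on stage 0: shift down
    to a syzygy of [N] along [Z], compare there, and shift up along [Z']. *)
Lemma cosyz_compare Z I i p Z' I' i' p' :
  @cosyzygies Z I i p -> @cosyzygies Z' I' i' p' ->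
  (forall N, ext1z N (Z 0%N) -> ext1z N (Z' 0%N)) ->
  forall j N, fin_gen N -> ext1z N (Z j) -> ext1z N (Z' j).
Proof.
move=> cz cz' H0; elim=> [|j IH] N fN NX; first exact: H0.
have [r [q qs]] := fin_gen_cover fN; have sq := ses_ker qs.
have [Ii si] := cz j; have [Ii' si'] := cz' j.
apply: (ext1z_shift_up sq si') => //; first exact: fin_gen_free.
  apply: IH; first exact: (noeth (fin_gen_free r)).
  exact: (ext1z_shift_down sq si (free_projective r)).
exact/ext1z_projective/free_projective.
Qed.

Lemma cosyz_ge Z I i p m j N : @cosyzygies Z I i p -> injective_module (Z m) ->
  (m <= j)%N -> fin_gen N -> ext1z N (Z j).
Proof.
move=> cz Xm; elim: j N => [|j IH] N.
  by rewrite leqn0 => /eqP <- _; exact: ext1z_injective.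
rewrite leq_eqVlt => /orP[/eqP<- _|]; first exact: ext1z_injective.
rewrite ltnS => mj fN; have [Ii si] := cz j.
have [r [q qs]] := fin_gen_cover fN; have sq := ses_ker qs.
apply: (ext1z_shift_up sq si) => //; first exact: fin_gen_free.
  exact/IH/noeth/fin_gen_free.
exact/ext1z_projective/free_projective.
Qed.

Section OfCoresolution.
Variables (M : lmodType R) (I : nat -> lmodType R) (eta : {linear M -> I 0%N})
  (d : forall j, {linear I j -> I j.+1}).

(** Stage 0 is [M] itself and not the image of [eta], so that results about cosyzygies apply to [M]
    literally. *)
Definition cosyz j : lmodType R :=
  match j with 0%N => M | j'.+1 => submod (imS (d j')) end.
Definition cosyz_incl j : {linear cosyz j -> I j} :=
  match j with 0%N => eta | j'.+1 => incl end.
Definition cosyz_proj j : {linear I j -> cosyz j.+1} := sval (cid (corestrict_im (d j))).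

Lemma cosyz_projE j x : incl (cosyz_proj j x) = d j x.
Proof. by rewrite /cosyz_proj; case: cid => g []. Qed.

Lemma cosyz_of_coresolution : injective_coresolution eta d -> cosyzygies cosyz_incl cosyz_proj.
Proof.
move=> [Ii etaI ex0 ex] j; split=> //.
have ps : surj (cosyz_proj j) by rewrite /cosyz_proj; case: cid => g [].
have p0 b : cosyz_proj j b = 0 <-> d j b = 0.
  by rewrite -cosyz_projE; split=> [->|h]; [rewrite linear0|exact: inj_eq0 (@incl_inj _ _ _) h].
split=> //.
  by case: j {ps p0} => [|j] //=; exact: incl_inj.
move=> b; rewrite p0; case: j b {ps p0} => [|j] b /=.
  have /= <- := congr1 (fun S => S b) ex0.
  by split=> [[x _ <-]|[x <-]]; exists x.
have /= <- := congr1 (fun S => S b) (ex j); split=> [[x _ <-]|[x <-]].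
  by apply: inclP; exact: mem_imS.
by have /imSP[y <-] := incl_mem x; exists y.
Qed.

(** The next cosyzygy lies in the zero module [I m.+1], so every map into it lifts trivially and
    [Ext^1(-, cosyz m)] vanishes. *)
Lemma cosyz_injective m : injective_coresolution eta d ->
  (forall j, (m < j)%N -> zero_module (I j)) -> injective_module (cosyz m).
Proof.
move=> cr z; have cz := cosyz_of_coresolution cr.
apply: injective_of_ext1z => [|N fN]; first exact: cosyz_fin_gen cz.
have [Ii s] := cz m; apply: (ext1z_of_lift s Ii) => u.
exists \0 => x; apply: incl_inj.
by rewrite (z m.+1 (ltnSn m) (incl (u x))) (z m.+1 (ltnSn m) (incl _)).
Qed.

End OfCoresolution.

End Ext.

(** The map [f] factors through the image of [d 0]. The obstruction to extending it lies in
    [Ext^1(im d_1, Z_0)], which dimension shifting identifies with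
    [Ext^(m+1)(im d_(m+1), Z_0) = 0]. *)
Lemma cosyz_extend (R : pzRingType) Z I i p m : @cosyzygies R Z I i p ->
  injective_module (Z m) ->
  forall (F : nat -> lmodType R) (d : forall j, {linear F j -> F j.+1}),
  (forall j, projective_module (F j)) ->
  (forall j y, d j.+1 y = 0 <-> exists x, d j x = y) ->
  forall f : {linear F 0%N -> Z 0%N}, (forall x, d 0%N x = 0 -> f x = 0) ->
  exists g : {linear F 1%N -> Z 0%N}, forall x, g (d 0%N x) = f x.
Proof.
elim: m Z I i p => [|m IH] Z I i p cz Zm F d Fp ex f fd.
  have [h [hd hs]] := corestrict_im (d 0%N).
  have [|f' f'h] := factor_surj (p := h) (g := f) hs.
    by move=> x hx; apply: fd; rewrite -hd hx linear0.
  case: Zm => _ Zi; have [g gP] := Zi _ _ incl f' (fin_gen_im _ (Fp 0%N).1) (Fp 1%N).1 (@incl_inj _ _ _).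
  by exists g => x; rewrite -hd gP f'h.
have [Ii s] := cz 0%N; have [iI ps _] := s.
have [h [hd hs]] := corestrict_im (d 0%N).
have [|f' f'h] := factor_surj (p := h) (g := f) hs.
  by move=> x hx; apply: fd; rewrite -hd hx linear0.
have [g gP] := Ii.2 _ _ incl (i 0%N \o f') (fin_gen_im _ (Fp 0%N).1) (Fp 1%N).1 (@incl_inj _ _ _).
(* The composite [p 0 \o g] vanishes on the kernel of [d 1], which is the image of [d 0]; the
   induction hypothesis applies to the complex from [F 1] on and the coresolution of [Z 1]. *)
have [|u uP] := IH (fun j => Z j.+1) (fun j => I j.+1) (fun j => i j.+1) (fun j => p j.+1)
   (fun j => cz j.+1) Zm (fun j => F j.+1) (fun j => d j.+1) (fun j => Fp j.+1)
   (fun j => ex j.+1) (p 0%N \o g).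
  by move=> x /ex[y <-]; rewrite /= -hd gP (ses_comp _ s).
have [v vP] := projective_lift u (Fp 2%N) Ii.1 ps.
have [|w wP] := ses_lift (g := g \- (v \o d 1%N)) s.
  by move=> x; rewrite /= linearB /= vP uP /= subrr.
exists w => x; apply: iI; rewrite wP /=.
have -> : d 1%N (d 0%N x) = 0 by apply/ex; exists x.
by rewrite linear0 subr0 -hd gP /= f'h.
Qed.

(** * Duality between free left and free right modules *)

Section Dual.
Variable L : nzRingType.

Lemma pairing_linear r (x : 'I_r -> L) (c : L^c) (u v : freemod (R := L^c) r) :
  \sum_(b < r) (x b : L) *: ((c *: u + v) b : L^o) =
  c *: ((\sum_(b < r) (x b : L) *: (u b : L^o) : L^o) : L^c^o) +
  ((\sum_(b < r) (x b : L) *: (v b : L^o) : L^o) : L^c^o) :> L.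
Proof.
transitivity ((\sum_(b < r) x b * (u b : L)) * (c : L) + \sum_(b < r) x b * (v b : L)).
  rewrite mulr_suml -big_split; apply: eq_bigr => b _ /=.
  rewrite !ffunE -mulrA; exact: mulrDr.
by [].
Qed.

(** The transpose of [d]: a functional is identified with its coordinates [y], and the value lists
    the coordinates of its composite with [d]. *)
Definition dual_fun r s (d : {linear freemod (R := L) s -> freemod (R := L) r})
  (y : freemod (R := L^c) r) : freemod (R := L^c) s :=
  [ffun a => lincomb (fun b => y b : (L^o : lmodType L)) (d (free_delta a))].

Lemma dual_linear r s d : linear (@dual_fun r s d).
Proof.
move=> c u v; apply/ffunP => a; rewrite !ffunE /=; exact: pairing_linear.
Qed.

Definition dual_map r s d : {linear freemod (R := L^c) r -> freemod (R := L^c) s} :=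
  linear_of (@dual_linear r s d).

Lemma dualE r s d y x :
  lincomb (fun b => @dual_map r s d y b : (L^o : lmodType L)) x =
  lincomb (fun b => y b : (L^o : lmodType L)) (d x).
Proof.
rewrite [in RHS](free_decomp x) !linear_sum; apply: eq_bigr => a _.
by rewrite ffunE !linearZ.
Qed.

Definition eval_dual r (x : freemod (R := L) r) (y : freemod (R := L^c) r) : L^c^o :=
  lincomb (fun b => y b : (L^o : lmodType L)) x.

Lemma eval_dual_linear r x : linear (@eval_dual r x).
Proof.
by move=> c u v; exact: pairing_linear.
Qed.

Definition eval_dual_lin r x := linear_of (@eval_dual_linear r x).

Lemma dual_coords r (f : {linear freemod (R := L) r -> (L^o : lmodType L)}) :
  exists y : freemod (R := L^c) r, forall x, lincomb (fun b => y b : (L^o : lmodType L)) x = f x.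
Proof.
by exists [ffun b => f (free_delta b)] => x; rewrite [RHS]free_mapE; apply: eq_bigr => b _; rewrite ffunE.
Qed.

Lemma dual_eq0 r (y : freemod (R := L^c) r) :
  (forall x, lincomb (fun b => y b : (L^o : lmodType L)) x = 0) -> y = 0.
Proof.
by move=> H; apply/ffunP => b; have := H (free_delta b); rewrite lincomb_delta ffunE.
Qed.

(** The form in which the finite injective dimension of the right regular module is used;
    [cosyz_extend] provides it. *)
Definition finite_right_dim : Prop :=
  forall (F : nat -> lmodType L^c) (d : forall j, {linear F j -> F j.+1}),
  (forall j, projective_module (F j)) ->
  (forall j y, d j.+1 y = 0 <-> exists x, d j x = y) ->
  forall f : {linear F 0%N -> L^c^o}, (forall x, d 0%N x = 0 -> f x = 0) ->
  exists g : {linear F 1%N -> L^c^o}, forall x, g (d 0%N x) = f x.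

Hypothesis rdim : finite_right_dim.

(** The dual of the free resolution is exact and consists of free right modules, so [rdim] applies
    to evaluation at a lift of [x]. Biduality of free modules then puts this lift into the image of
    the first differential, so that [x = 0]. *)
Lemma torsionless_of_res (r : nat -> nat) (K : nat -> lmodType L)
   (i : forall j, {linear K j.+1 -> freemod (r j)}) (p : forall j, {linear freemod (r j) -> K j}) :
  (forall j, ses (i j) (p j)) -> (forall j, fin_gen (K j)) ->
  (forall j, ext1z (K j) (L^o : lmodType L)) ->
  forall x : K 0%N, (forall phi : {linear K 0%N -> (L^o : lmodType L)}, phi x = 0) -> x = 0.
Proof.
move=> s fK eK x x0.
pose d j : {linear freemod (r j.+1) -> freemod (r j)} := i j \o p j.+1.
have dd0 j w : d j (d j.+1 w) = 0 by rewrite /= (ses_comp _ (s j.+1)) linear0.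
have im_d j (f : {linear freemod (r j) -> (L^o : lmodType L)}) : (forall z, f (d j z) = 0) ->
    exists h : {linear K j -> (L^o : lmodType L)}, forall z, h (p j z) = f z.
  move=> fd; apply: (ses_factor (s j)) => a.
  by have [_ ps _] := s j.+1; have [z <-] := ps a; exact: fd.
(* A functional that vanishes on the image of [d j.+1] descends to [K j.+1] and extends along [i j],
   because [Ext^1(K j, L) = 0]. *)
have ex j (y : freemod (R := L^c) (r j.+1)) :
    dual_map (d j.+1) y = 0 <-> exists z, dual_map (d j) z = y.
  split=> [y0|[z <-]]; last first.
    by apply: dual_eq0 => w; rewrite !dualE dd0 linear0.
  have [|h hp] := im_d j.+1 (lincomb (fun b => y b : (L^o : lmodType L))).
    by move=> z; rewrite -dualE y0 /= big1// => b _; rewrite ffunE scaler0.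
  have [g gi] := eK j _ _ (i j) (p j) (fK j.+1) (fin_gen_free _) (s j) h.
  have [z zg] := dual_coords g; exists z; apply/eqP; rewrite -subr_eq0; apply/eqP.
  apply: dual_eq0 => w.
  have -> : lincomb (fun b => (dual_map (d j) z - y) b : (L^o : lmodType L)) w =
     lincomb (fun b => dual_map (d j) z b : (L^o : lmodType L)) w - lincomb (fun b => y b : (L^o : lmodType L)) w.
    rewrite /= -sumrB; apply: eq_bigr => b _; rewrite !ffunE.
    by rewrite -scalerBr.
  by rewrite dualE zg /= gi hp subrr.
have [_ ps0 e0] := s 0%N; have [xt xtE] := ps0 x.
(* A functional in the kernel of the first dual map comes from [K 0], where it annihilates [x]; so
   evaluation at [xt] vanishes on that kernel. *)
have [|g gP] := rdim (F := fun j => freemod (r j)) (d := fun j => dual_map (d j))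
   (fun j => free_projective _) ex (f := eval_dual_lin xt).
  move=> y y0 /=; rewrite /eval_dual.
  have [|h hp] := im_d 0%N (lincomb (fun b => y b : (L^o : lmodType L))).
    by move=> z; rewrite -dualE y0 /= big1// => b _; rewrite ffunE scaler0.
  by rewrite -hp xtE.
(* The coordinates of [g] form an element that [d 0] sends to [xt]. *)
suff -> : x = p 0%N (d 0%N [ffun a => g (free_delta a) : L]) by rewrite /= (ses_comp _ (s 0%N)).
rewrite -xtE; congr (p 0%N _); apply/ffunP => b.
have -> : xt b = eval_dual xt (free_delta b).
  rewrite /eval_dual /= (bigD1 b)//= big1 => [|a ab]; rewrite ffunE.
    by rewrite eqxx addr0 /GRing.scale /= mulr1.
  by rewrite (negPf ab) scaler0.
rewrite -[LHS]gP (free_mapE g) [d 0%N _]free_mapE sum_ffunE.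
refine (@eq_bigr L 0 +%R _ _ _ _ _ _) => a _.
rewrite !ffunE /= (bigD1 b)//= big1 => [|c cb]; rewrite ffunE.
  by rewrite eqxx addr0 /GRing.scale /= mulr1.
by rewrite (negPf cb) scaler0.
Qed.

(** The functionals on [K] are those on a free cover that kill the kernel. They form a submodule of
    a free right module, whose finitely many generators are the components of [a]. *)
Lemma left_approx (noethc : fg_noetherian L^c) (K : lmodType L) : fin_gen K ->
  exists m (a : {linear K -> freemod m}), forall phi : {linear K -> (L^o : lmodType L)},
    exists psi : {linear freemod m -> (L^o : lmodType L)}, forall x, psi (a x) = phi x.
Proof.
move=> fK; have [r [p ps]] := fin_gen_cover fK.
pose ev (y : freemod (R := L^c) r) := lincomb (fun b => y b : (L^o : lmodType L)).
have W0 x : p x = 0 -> ev 0 x = 0.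
  by move=> _; rewrite /= big1// => b _; rewrite ffunE scaler0.
have Wl a u v : (forall x, p x = 0 -> ev u x = 0) -> (forall x, p x = 0 -> ev v x = 0) ->
  forall x, p x = 0 -> ev (a *: u + v) x = 0.
  move=> hu hv x px; rewrite -[LHS]/(eval_dual_lin x (a *: u + v)) linearP.
  by rewrite [eval_dual_lin x u]hu// [eval_dual_lin x v]hv// scaler0 addr0.
have /spannedP[m [g [gW gP]]] := noethc _ (fin_gen_free r) (submod_of W0 Wl).
have /choice[phi phiP] t : exists h : {linear K -> (L^o : lmodType L)}, forall x, h (p x) = ev (g t) x.
  by apply: factor_surj => // x px; have /in_submod_of := gW t; exact.
have al : linear (fun x => [ffun t => phi t x] : freemod m).
  by move=> c u v; apply/ffunP => t; rewrite !ffunE linearP.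
exists m, (linear_of al) => h.
have [y yE] := dual_coords (h \o p).
have [|c yc] := gP y.
  by apply/in_submod_of => x px; rewrite [LHS]yE /= px linear0.
exists (lincomb (fun t => c t : (L^o : lmodType L))) => x; have [z <-] := ps x.
rewrite -[RHS]yE /=.
transitivity (\sum_(t < m) eval_dual_lin z (c t *: g t)).
  by apply: eq_bigr => t _; rewrite linearZ /= ffunE phiP.
by rewrite -linear_sum -yc.
Qed.

End Dual.

(** * Gorenstein projective modules *)

Lemma bi_infinite_choice (T : Type) (Q : T -> Prop) (rel : T -> T -> Prop) (x0 : T) :
  Q x0 -> (forall x, Q x -> exists y, Q y /\ rel x y) ->
  (forall x, Q x -> exists y, Q y /\ rel y x) ->
  exists s : int -> T,
    [/\ s 0 = x0, forall i, Q (s i) & forall i, rel (s i) (s (i + 1))].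
Proof.
move=> Q0 nxt prv.
have [u [u0 uQ ur]] := dependent_choice Q0 nxt.
have [v [v0 vQ vr]] := dependent_choice Q0 prv.
(* [Negz n] stands for [-(n + 1)], so the backward sequence enters at index 1; its term 0 is [x0],
   which is also [u 0]. *)
exists (fun i => match i with Posz n => u n | Negz n => v n.+1 end); split=> //.
  by case.
case=> [m|[|m]].
- by rewrite -PoszD addn1; exact: ur.
- by rewrite /= u0 -v0; exact: vr.
- have -> : Negz m.+1 + 1 = Negz m by rewrite !NegzE [in LHS]intS opprD addrAC addNr add0r.
  exact: vr.
Qed.

Section GProj.
Variable L : nzRingType.
Hypothesis noeth : fg_noetherian L.
Hypothesis noethc : fg_noetherian L^c.
Hypothesis rdim : finite_right_dim L.
Variables (Z I : nat -> lmodType L) (iZ : forall j, {linear Z j -> I j})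
  (pZ : forall j, {linear I j -> Z j.+1}).
Hypothesis cz : cosyzygies iZ pZ.
Let Lo : lmodType L := L^o.
Hypothesis Z0 : forall N, ext1z N (Z 0%N) <-> ext1z N Lo.
Implicit Types K M N : lmodType L.

(** All higher [Ext^i(N, L)] vanish, since [Ext^1(N, Z j)] is [Ext^(j+1)(N, L)]. These modules turn
    out to be the Gorenstein projective ones. *)
Definition perp N : Prop := fin_gen N /\ forall j, ext1z N (Z j).

Lemma perp_iso M N (e : {linear M -> N}) : injective e -> surj e -> perp N -> perp M.
Proof.
move=> eI es [fN H]; split=> [|j]; first exact: (fin_gen_inj noeth eI fN).
exact: (ext1z_iso eI es (H j)).
Qed.

Lemma perp_syz K r N (i : {linear K -> freemod r}) (p : {linear freemod r -> N}) :
  ses i p -> perp N -> perp K.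
Proof.
move=> s [fN H]; have [iI _ _] := s.
split=> [|j]; first exact: (fin_gen_inj noeth iI (fin_gen_free r)).
have [Ii sz] := cz j.
exact: (ext1z_shift_down noeth s sz (free_projective r) Ii (H j.+1)).
Qed.

(** The resolved module [Ks 0] is [K]; the injection [e] records this without an equality of
    modules. *)
Lemma perp_resolution K : perp K ->
  exists (r : nat -> nat) (Ks : nat -> lmodType L)
    (i : forall j, {linear Ks j.+1 -> freemod (r j)})
    (p : forall j, {linear freemod (r j) -> Ks j}) (e : {linear K -> Ks 0%N}),
    [/\ forall j, ses (i j) (p j), forall j, perp (Ks j) & injective e].
Proof.
move=> pK; pose T := {N : lmodType L | perp N}.
have cov (N : T) : {w : {r & {linear freemod (R := L) r -> sval N}} | surj (projT2 w)}.
  apply: cid; have [r [p ps]] := fin_gen_cover (svalP N).1.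
  by exists (existT _ r p).
pose f (N : T) := sval (cov N); have fP (N : T) : surj (projT2 (f N)) by exact: (svalP (cov N)).
pose next (N : T) : T := exist perp (submod (kerS (projT2 (f N))) : lmodType L)
   (perp_syz (ses_ker (fP N)) (svalP N)).
pose S j := iter j next (exist _ K pK).
exists (fun j => projT1 (f (S j))), (fun j => sval (S j)),
  (fun j => incl), (fun j => projT2 (f (S j))), (idfun : {linear K -> K}).
by split=> // j; [exact: ses_ker | exact: svalP].
Qed.

Lemma perp_torsionless K : perp K -> forall x : K,
  (forall phi : {linear K -> Lo}, phi x = 0) -> x = 0.
Proof.
move=> /perp_resolution[r [Ks [i [p [e [s pKs eI]]]]]] x H; apply: (inj_eq0 eI).
apply: (torsionless_of_res rdim s) => [j|j|phi]; first exact: (pKs j).1.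
  exact/Z0/((pKs j).2 0%N).
exact: (H (phi \o e)).
Qed.

(** The approximation is injective because [K] is torsionless; extension of functionals along it
    keeps the cokernel orthogonal to [L]. *)
Lemma perp_embed K : perp K -> exists m (a : {linear K -> freemod m}), injective a /\
  forall phi : {linear K -> Lo},
    exists psi : {linear freemod m -> Lo}, forall x, psi (a x) = phi x.
Proof.
move=> pK; have [m [a aP]] := left_approx noethc pK.1; exists m, a; split=> //.
apply: linear_inj => x ax; apply: (perp_torsionless pK) => phi.
by have [psi <-] := aP phi; rewrite ax linear0.
Qed.

(* Matrices are indexed by nat, so that the terms and the differentials of a
   complex can be given without type casts. *)
Definition mxmap r s (D : nat -> nat -> L) : {linear freemod (R := L) r -> freemod (R := L) s} :=
  lincomb (fun a : 'I_r => [ffun b : 'I_s => D a b] : freemod s).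

Lemma mx_exists r s (f : {linear freemod (R := L) r -> freemod (R := L) s}) :
  exists D, forall x, mxmap r s D x = f x.
Proof.
exists (fun a b => if insub a is Some a then
  if insub b is Some b then f (free_delta (a : 'I_r)) (b : 'I_s) else 0 else 0) => x.
rewrite [RHS]free_mapE; apply: eq_bigr => a _; congr (_ *: _).
by apply/ffunP => b; rewrite ffunE !valK.
Qed.

(** One differential of a complex: source rank, target rank, matrix. *)
Let state := (nat * nat * (nat -> nat -> L))%type.
Let smap (st : state) := mxmap st.1.1 st.1.2 st.2.

Definition gp_state (st : state) : Prop :=
  perp (submod (imS (smap st))) /\
  forall f : {linear submod (imS (smap st)) -> Lo},
    exists g : {linear freemod st.1.2 -> Lo}, forall x, g (incl x) = f x.

Definition gp_rel (st st' : state) : Prop :=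
  st.1.2 = st'.1.1 /\
  forall y : freemod st.1.2, mxmap st.1.2 st'.1.2 st'.2 y = 0 <->
    exists x, smap st x = y.

Lemma gp_state_embed K r m (p : {linear freemod r -> K}) (a : {linear K -> freemod m}) D :
  perp K -> surj p -> injective a ->
  (forall phi : {linear K -> Lo},
    exists psi : {linear freemod m -> Lo}, forall x, psi (a x) = phi x) ->
  (forall x, mxmap r m D x = a (p x)) -> gp_state (r, m, D).
Proof.
move=> pK ps aI aP DE.
have [|b bP] := @lift_inj _ _ _ _ a (@incl _ _ (imS (smap (r, m, D)))) aI.
  by move=> c; have /imSP[x <-] := incl_mem c; exists (p x); rewrite [RHS]DE.
have bs : surj b.
  move=> x; have [y yx] := ps x.
  have [c cE] := inclP (mem_imS (smap (r, m, D)) y).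
  by exists c; apply: aI; rewrite bP cE [LHS]DE yx.
have bI : injective b by move=> u v uv; apply: incl_inj; rewrite -!bP uv.
split; first exact: perp_iso bI bs pK.
have [b' b'b] := lift_inj (f := (idfun : {linear K -> K})) bI bs.
move=> f; have [psi psiP] := aP (f \o b'); exists psi => x.
by rewrite -bP psiP /=; congr (f _); apply: bI; rewrite b'b.
Qed.

(** The cokernel of the differential is again in [perp]: at [Z 0] because functionals on the image
    extend, at later stages by shifting. Embedding this cokernel gives the next differential. *)
Lemma gp_next st : gp_state st -> exists st', gp_state st' /\ gp_rel st st'.
Proof.
case: st => [[r s] D] [pI ext].
have sq := ses_quot (imS (smap (r, s, D))); have [_ qs e] := sq.
have pC : perp (quotmod (imS (smap (r, s, D)))).
  split=> [|[|j]]; first exact: (fin_gen_surj qs (fin_gen_free s)).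
    apply/Z0; apply: (ext1z_of_pres sq (fin_gen_free s)) => //.
    exact/ext1z_projective/free_projective.
  have [Ii sz] := cz j.
  apply: (ext1z_shift_up noeth sq sz (fin_gen_free s) Ii (pI.2 j)).
  exact/ext1z_projective/free_projective.
have [m [a [aI aP]]] := perp_embed pC.
have [D' D'E] := mx_exists (a \o quot_proj (imS (smap (r, s, D)))).
exists (s, m, D'); split; first exact: (gp_state_embed pC qs aI aP D'E).
split=> // y; rewrite [mxmap _ _ _ _]D'E /=; split=> [/(inj_eq0 aI)/e[c <-]|[x xy]].
  by have /imSP := incl_mem c.
have y0 : quot_proj (imS (smap (r, s, D))) y = 0.
  by apply/e; apply: inclP; apply/imSP; exists x.
by rewrite [LHS](congr1 a y0) linear0.
Qed.

(** A free cover of the kernel gives the previous differential; its image is a syzygy of the image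
    at hand. *)
Lemma gp_prev st : gp_state st -> exists st', gp_state st' /\ gp_rel st' st.
Proof.
case: st => [[r s] D] [pI ext].
have [q [p ps]] := fin_gen_cover (noeth (fin_gen_free r) (kerS (smap (r, s, D)))).
have [D' D'E] := mx_exists (incl \o p).
have ex y : smap (r, s, D) y = 0 <-> exists x, smap (q, r, D') x = y.
  split=> [/kerSP/inclP[z <-]|[x <-]].
    by have [x <-] := ps z; exists x; rewrite [LHS]D'E.
  by apply/kerSP; rewrite [X in X \in _]D'E; exact: incl_mem.
have [h [hE hs]] := corestrict_im (smap (r, s, D)).
have sh : ses (@incl _ _ (imS (smap (q, r, D')))) h.
  split=> //; first exact: incl_inj.
  move=> b; split=> [hb|[a <-]].
    by apply: inclP; apply/imSP/ex; rewrite -hE hb linear0.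
  have /imSP/ex h0 := incl_mem a.
  by apply: (@incl_inj _ _ (imS (smap (r, s, D)))); rewrite hE h0 linear0.
exists (q, r, D'); split; last by split=> // y; exact: ex.
split; first exact: perp_syz sh pI.
have fgi : fin_gen (submod (imS (smap (q, r, D')))) by exact: (noeth (fin_gen_free r)).
exact: ((Z0 _).1 (pI.2 0%N) _ _ _ _ fgi (fin_gen_free r) sh).
Qed.

Lemma gp_complex (st : int -> state) : (forall i, gp_state (st i)) ->
  (forall i, gp_rel (st i) (st (i + 1))) ->
  totally_acyclic (P := fun i => freemod (st i).1.1)
    (fun i => mxmap (st i).1.1 (st (i + 1)).1.1 (st i).2).
Proof.
move=> Q rel.
(* Three arbitrary states are taken so that the equalities of ranks in [gp_rel] can be
   substituted. *)
have step s1 s2 s3 : gp_rel s1 s2 -> gp_rel s2 s3 -> gp_state s2 ->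
   (forall y, mxmap s2.1.1 s3.1.1 s2.2 y = 0 <-> exists x, mxmap s1.1.1 s2.1.1 s1.2 x = y) /\
   forall f : {linear freemod s2.1.1 -> Lo},
     (forall y, mxmap s2.1.1 s3.1.1 s2.2 y = 0 -> f y = 0) ->
     exists g : {linear freemod s3.1.1 -> Lo}, forall y, f y = g (mxmap s2.1.1 s3.1.1 s2.2 y).
  case: s1 s2 s3 => [[r1 t1] D1] [[r2 t2] D2] [[r3 t3] D3] [/= e1 H1] [/= e2 _] [_ ext].
  subst t1; subst t2; split; first exact: H1.
  move=> f f0; have [h [hE hs]] := corestrict_im (smap (r2, r3, D2)).
  have [|u uh] := factor_surj (g := f) hs.
    by move=> a ha; apply: f0; rewrite -[LHS]hE ha linear0.
  have [g gP] := ext u; exists g => y.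
  by rewrite -uh -gP; congr (g _); exact: hE.
split=> [i|i|i f]; first exact: free_projective.
  have [H _] := step _ _ _ (rel i) (rel (i + 1)) (Q (i + 1)).
  apply/seteqP; split=> [y [x _ <-]|y /H[x <-]]; last by exists x.
  by apply/H; exists x.
have [H ext] := step _ _ _ (rel i) (rel (i + 1)) (Q (i + 1)).
split=> [f0|[g gP] x].
  by apply: ext => y /H[x <-]; exact: f0.
by rewrite gP (_ : mxmap _ _ _ _ = 0) ?linear0//; apply/H; exists x.
Qed.

Lemma gorenstein_projective_of_perp K : perp K -> gorenstein_projective K.
Proof.
move=> pK; have [r [p ps]] := fin_gen_cover pK.1.
have [m [a [aI aP]]] := perp_embed pK.
have [D DE] := mx_exists (a \o p).
have Q0 : gp_state (r, m, D) := gp_state_embed pK ps aI aP DE.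
have [st [st0 stQ strel]] := bi_infinite_choice Q0 gp_next gp_prev.
exists (fun i => freemod (st i).1.1), (fun i => mxmap (st i).1.1 (st (i + 1)).1.1 (st i).2).
split; first exact: gp_complex.
exists 0; have [e _] := strel 0; move: e; rewrite st0 /= => e.
move: (st (0 + 1)).1.1 e => _ <-; exists a; split=> //.
apply/seteqP; split=> [y [x _ <-]|y [x _ <-]].
  by have [z <-] := ps x; exists z => //; exact: DE.
by exists (p x) => //; exact/esym/DE.
Qed.

(** Each image is the kernel of the next differential. Exactness of [Hom(-, L)] settles stage 0 for
    all images, and each later stage follows by shifting from the image one place to the left. *)
Lemma totally_acyclic_im (P : int -> lmodType L) (d : forall i : int, {linear P i -> P (i + 1)}) j i :
  totally_acyclic d -> ext1z (submod (imS (d i))) (Z j).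
Proof.
move=> [Pp ex hex].
have s i' : exists h : {linear P (i' + 1) -> submod (imS (d (i' + 1)))},
    ses (@incl _ _ (imS (d i'))) h /\ forall x, incl (h x) = d (i' + 1) x.
  have [h [hE hs]] := corestrict_im (d (i' + 1)); exists h; split=> //.
  split=> //; first exact: incl_inj.
  move=> b; have /= exb := congr1 (fun S => S b) (ex i').
  have h0 : h b = 0 <-> d (i' + 1) b = 0.
    by rewrite -hE; split=> [->|/(inj_eq0 (@incl_inj _ _ _))//]; rewrite linear0.
  rewrite h0 -exb; split=> [[x _ <-]|[x <-]]; first exact/inclP/mem_imS.
  by have /imSP[y <-] := incl_mem x; exists y.
elim: j i => [|j IH] i.
  apply/Z0.
  have [i' ->] : exists i', i = i' + 1 + 1 by exists (i - 1 - 1); rewrite !subrK.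
  have [h [sh hE]] := s (i' + 1).
  apply: (ext1z_of_pres sh (Pp _).1); first exact: ext1z_projective.
  move=> f; have [h' [sh' h'E]] := s i'.
  have [|g gP] := (hex i' (f \o h')).1.
    move=> x /=; rewrite (_ : h' _ = 0) ?linear0//.
    have [c cE] := inclP (mem_imS (d i') x).
    by rewrite -cE (ses_comp _ sh').
  exists g => c; have [_ hs _] := sh'; have [y <-] := hs c.
  by rewrite h'E -gP.
have [i' ->] : exists i', i = i' + 1 by exists (i - 1); rewrite subrK.
have [h [sh hE]] := s i'; have [Ii sz] := cz j.
apply: (ext1z_shift_up noeth sh sz (Pp _).1 Ii (IH _)).
exact: ext1z_projective.
Qed.

Lemma perp_of_gorenstein_projective K : gorenstein_projective K -> perp K.
Proof.
move=> [P [d [ta [i [f [fI fr]]]]]].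
have [Pp _ _] := ta.
split; first exact: (fin_gen_inj noeth fI (Pp _).1).
move=> j; have inr x : exists y, @incl _ _ (imS (d i)) y = f x.
  apply: inclP; have : range f (f x) by exists x.
  by rewrite fr => -[y _ <-]; exact: mem_imS.
have [e eE] := lift_inj (f := f) (@incl_inj _ _ (imS (d i))) inr.
apply: (ext1z_iso (e := e) _ _ (totally_acyclic_im ta)).
  by move=> x y xy; apply: fI; rewrite -!eE xy.
move=> y; have /imSP[z zE] := incl_mem y.
have : range (d i) (d i z) by exists z.
by rewrite -fr => -[x _ xE]; exists x; apply: incl_inj; rewrite eE xE.
Qed.

(** Replacing [N] by the kernel of [eps] shortens the resolution; at length 0, [N] is isomorphic to
    [G 0]. *)
Lemma ext1z_of_gp_resolution l N : has_gorenstein_projective_resolution_of_length N l ->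
  fin_gen N /\ forall j, (l <= j)%N -> ext1z N (Z j).
Proof.
elim: l N => [|l IH] N [G [eps [d [gp es ex0 ex z]]]].
  have epsI : injective eps.
    apply: linear_inj => x epsx; have : range (d 0%N) x by rewrite ex0.
    by move=> [y _ <-]; rewrite (z 1%N _ y)// linear0.
  have [e [eI e_s]] := bijective_inverse epsI es.
  by have [fN H] := perp_iso eI e_s (perp_of_gorenstein_projective (gp 0%N)).
have pG := perp_of_gorenstein_projective (gp 0%N).
have s := ses_ker es.
have H x : exists y, @incl _ _ (kerS eps) y = d 0%N x.
  apply: inclP; apply/kerSP; have /= <- := congr1 (fun S => S (d 0%N x)) ex0.
  by exists x.
have [eps' eps'E] := lift_inj (@incl_inj _ _ (kerS eps)) H.
have [|fN' H'] := IH (submod (kerS eps)).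
  exists (fun j => G j.+1), eps', (fun j => d j.+1); split=> //.
  - move=> y; have /kerSP y0 := incl_mem y.
    have : range (d 0%N) (incl y) by rewrite ex0.
    by move=> [x _ xE]; exists x; apply: incl_inj; rewrite eps'E.
  - rewrite /exact_pair (ex 0%N); apply/seteqP; split=> y /= h.
      by apply: incl_inj; rewrite eps'E h linear0.
    by rewrite -eps'E h linear0.
  - by move=> j lj; apply: z.
split; first exact: (fin_gen_surj es pG.1).
case=> // j lj; have [Ii sz] := cz j.
exact: (ext1z_shift_up noeth s sz pG.1 Ii (H' j lj) (pG.2 _)).
Qed.

Lemma free_perp r : perp (freemod r).
Proof.
split; first exact: fin_gen_free.
by move=> j; exact/ext1z_projective/free_projective.
Qed.

Lemma gp_resolution_of_ext1z l N : fin_gen N -> (forall j, (l <= j)%N -> ext1z N (Z j)) ->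
  has_gorenstein_projective_resolution_of_length N l.
Proof.
elim: l N => [|l IH] N fN H.
  (* [freemod 0] is the zero module that fills the degrees beyond the length. *)
  pose G j : lmodType L := if j is 0%N then N else freemod 0.
  exists G, (idfun : {linear N -> N}), (fun j => \0 : {linear G j.+1 -> G j}).
  have f0 (x y : freemod (R := L) 0) : x = y by apply/ffunP; case.
  split=> //.
  - case=> [|j]; apply: gorenstein_projective_of_perp; last exact: free_perp.
    by split=> // j; exact: H.
  - by move=> y; exists y.
  - apply/seteqP; split=> [y [x _ <-]//|y /= ->]; exists 0 => //.
  - by move=> j; apply/seteqP; split=> [y _|y _]; [by [] | exists 0; [|exact: f0]].
  - by case=> // j _ x; exact: f0.
have [r [p ps]] := fin_gen_cover fN.
have s := ses_ker ps; have [iI _ e] := s.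
have [||G [eps [d [gp es ex0 ex z]]]] := IH (submod (kerS p)).
- exact: (noeth (fin_gen_free r)).
- move=> j lj; have [Ii sz] := cz j.
  exact: (ext1z_shift_down noeth s sz (free_projective r) Ii (H j.+1 lj)).
pose G' j : lmodType L := if j is j'.+1 then G j' else freemod r.
exists G', p,
  (fun j => match j return {linear G' j.+1 -> G' j} with
    | 0%N => (incl \o eps : {linear G 0%N -> freemod r}) | j'.+1 => d j' end).
split=> //.
- by case=> [|j]; [exact/gorenstein_projective_of_perp/free_perp|exact: gp].
- apply/seteqP; split=> [y [x _ <-]|y /e[a <-]] /=; first exact: (ses_comp _ s).
  by have [x <-] := es a; exists x.
- case=> [|j]; last exact: ex.
  rewrite /exact_pair ex0; apply/seteqP; split=> y /= h.
    by rewrite h linear0.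
  exact: inj_eq0 iI h.
- by case=> // j lj; exact: z.
Qed.

Variable n : nat.
Hypothesis Zn1 : injective_module (Z n.+1).

(** Since [Z n.+1] is injective, the conditions at stages beyond [n] hold for every [N], which
    leaves the one at [n]. *)
Lemma Gpd_leP N : fin_gen N -> Gpd_le N n <-> ext1z N (Z n).
Proof.
move=> fN; split=> [[l ln /ext1z_of_gp_resolution[_]]|H]; first exact.
exists n => //; apply: gp_resolution_of_ext1z => // j.
rewrite leq_eqVlt => /orP[/eqP<-//|nj].
exact: (cosyz_ge noeth cz Zn1 nj fN).
Qed.

End GProj.

(** * Injective hulls and minimal coresolutions *)

Section Hulls.
Context {R : pzRingType}.
Hypothesis noeth : fg_noetherian R.
Hypothesis art : fg_artinian R.
Implicit Types A B C E I J M N P Q X : lmodType R.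

Lemma injective_retract E I (s : {linear E -> I}) (r : {linear I -> E}) :
  (forall x, r (s x) = x) -> injective_module I -> injective_module E.
Proof.
move=> rs [fI Ii]; split.
  by apply: (fin_gen_surj (p := r)) fI => x; exists (s x).
move=> A B i f fA fB iI; have [g gi] := Ii _ _ i (s \o f) fA fB iI.
by exists (r \o g) => a; rewrite /= gi /= rs.
Qed.

Lemma projective_retract E P (s : {linear E -> P}) (r : {linear P -> E}) :
  (forall x, r (s x) = x) -> projective_module P -> projective_module E.
Proof.
move=> rs [fP Pp]; split.
  by apply: (fin_gen_surj (p := r)) fP => x; exists (s x).
move=> A B q f fA fB qs; have [g gq] := Pp _ _ q (f \o r) fA fB qs.
by exists (g \o s) => a; rewrite /= gq /= rs.
Qed.

Lemma injective_prod A B : injective_module A -> injective_module B ->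
  injective_module (A * B)%type.
Proof.
move=> [fA Ai] [fB Bi]; split; first exact: fin_gen_prod.
move=> C D i f fC fD iI.
have [g gi] := Ai _ _ i (lfst A B \o f) fC fD iI.
have [h hi] := Bi _ _ i (lsnd A B \o f) fC fD iI.
by exists (pair_map g h) => x; rewrite /= gi hi /= -surjective_pairing.
Qed.

Lemma projective_prod A B : projective_module A -> projective_module B ->
  projective_module (A * B)%type.
Proof.
move=> [fA Ap] [fB Bp]; split; first exact: fin_gen_prod.
move=> C D q f fC fD qs.
have [g gq] := Ap _ _ q (f \o pair_map (idfun : {linear A -> A}) (\0 : {linear A -> B})) fC fD qs.
have [h hq] := Bp _ _ q (f \o pair_map (\0 : {linear B -> A}) (idfun : {linear B -> B})) fC fD qs.
exists (copair g h) => -[a b]; rewrite /= linearD /= gq hq /= -linearD.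
by congr (f (_, _)); rewrite ?addr0 ?add0r.
Qed.

Lemma iter_linear M (f : {linear M -> M}) n : linear (iter n f).
Proof. by elim: n => [|n IH] a u v //=; rewrite IH linearP. Qed.

(** The union of the kernels of all powers is finitely generated, hence killed by one power [m]. If
    [f x = 0], write [x] as the [m]-th iterate of [f] at some [y]; then [y] lies in that union and
    [x = 0]. *)
Lemma surj_endo_inj M (f : {linear M -> M}) : fin_gen M -> surj f -> injective f.
Proof.
move=> fM fs.
pose F n := linear_of (iter_linear f n).
have F_le n m x : (n <= m)%N -> iter n f x = 0 -> iter m f x = 0.
  by move=> /subnK<- h; rewrite iterD h; exact: (linear0 (F _)).
have U0 : exists n, iter n f 0 = 0 by exists 0%N.
have Ul a u v : (exists n, iter n f u = 0) -> (exists n, iter n f v = 0) ->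
   exists n, iter n f (a *: u + v) = 0.
  move=> [n nu] [m mv]; exists (maxn n m); rewrite iter_linear.
  rewrite (F_le _ _ _ (leq_maxl n m) nu) (F_le _ _ _ (leq_maxr n m) mv).
  by rewrite scaler0 addr0.
have /spannedP[r [g [gU gP]]] := noeth fM (submod_of U0 Ul).
have /choice[b bP] i : exists n, iter n f (g i) = 0 by have /in_submod_of := gU i.
pose m := (\max_(i < r) b i)%N.
have Um x : (exists n, iter n f x = 0) -> iter m f x = 0.
  move=> /(in_submod_of U0 Ul)/gP[c ->]; rewrite [LHS](linear_sum (F m)) big1// => i _.
  rewrite (linearZ_LR (F m)) /= (F_le _ _ _ _ (bP i)) ?scaler0//.
  exact: leq_bigmax.
have itS n x : exists y, iter n f y = x.
  elim: n x => [|n IH] x; first by exists x.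
  by have [y <-] := fs x; have [z <-] := IH y; exists z.
apply: linear_inj => x fx; have [y yx] := itS m x.
by rewrite -yx; apply: Um; exists m.+1; rewrite iterS yx.
Qed.

(* The hull is the image of an endomorphism of I that fixes M and has minimal
   image. *)
Lemma injective_hull M I (j : {linear M -> I}) : injective j -> injective_module I ->
  exists (E : submodClosed I) (r : {linear I -> submod E}),
    [/\ forall x, r (incl x) = x, forall m, j m \in E &
      forall S : submodClosed I, {subset S <= E} -> (exists2 y, y \in S & y != 0) ->
        exists2 m, j m \in S & j m != 0].
Proof.
move=> jI Ii; have [fI _] := Ii.
have fM := fin_gen_inj noeth jI fI.
pose Phi (S : submodClosed I) := exists e : {linear I -> I},
  (forall m, e (j m) = j m) /\ S =i imS e.
have [|E0 [[e [ej eE]] Emin]] := @artinian_minimal _ _ Phi (imS (idfun : {linear I -> I})) (art fI).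
  by exists idfun.
pose E := imS e.
(* The composite [c \o e] still fixes [M] and has its image inside [E], so by minimality its image
   is [E]. *)
have minE (c : {linear I -> I}) : (forall m, c (j m) = j m) -> (forall x, c x \in E) ->
    forall y, y \in E -> exists x, c (e x) = y.
  move=> cj cE y yE.
  have Pc : Phi (imS (c \o e)).
    by exists (c \o e); split=> // m; rewrite /= ej cj.
  have sub : {subset imS (c \o e) <= E0}.
    by move=> z /imSP[x <-]; rewrite eE; exact: cE.
  apply/(imSP (c \o e) y); apply: (Emin _ Pc sub).
  by rewrite eE.
(* So [c] restricts to a surjective, hence bijective, endomorphism of [E]. For [c = e] the inverse
   turns [e] into a retraction onto [E]. *)
have bij (c : {linear I -> I}) : (forall m, c (j m) = j m) -> (forall x, c x \in E) ->
    exists g : {linear submod E -> submod E},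
      [/\ forall x, incl (g x) = c (incl x), injective g & surj g].
  move=> cj cE.
  have [g gE] := lift_inj (f := c \o @incl _ _ E) (@incl_inj _ _ E) (fun x => inclP (cE (incl x))).
  have gs : surj g.
    move=> y; have [x xy] := minE c cj cE _ (incl_mem y).
    have [z zE] := inclP (mem_imS e x); exists z; apply: incl_inj.
    by rewrite gE /= zE.
  exists g; split=> //; apply: surj_endo_inj gs.
  exact: noeth.
have [g [gE gI gs]] := bij e ej (mem_imS e).
have [g' g'E] := lift_inj (f := (idfun : {linear submod E -> submod E})) gI gs.
have [e' [e'E e's]] := corestrict_im e.
exists E, (g' \o e'); split=> [x|m|S SE [y yS y0]].
- by apply: gI; rewrite /= g'E; apply: incl_inj; rewrite e'E gE.
- by rewrite -ej; exact: mem_imS.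
apply: contrapT => nS.
have disj m : j m \in S -> j m = 0.
  by move=> jS; apply: contrapT => /eqP j0; apply: nS; exists m.
(* If [S] meets [M] trivially, the map on the sum of [M] and [S] that fixes [M] and kills [S]
   extends to [I]. Followed by [e] it is injective on [E], so [S] would be zero. *)
have cI : injective (copair j (@incl _ _ S)).
  apply: linear_inj => -[m s] /= /eqP; rewrite addr_eq0 => /eqP js.
  have j0 : j m = 0 by apply: disj; rewrite js -scaleN1r rpredZ ?incl_mem.
  rewrite (inj_eq0 jI j0); congr (_, _).
  by apply: (inj_eq0 (@incl_inj _ _ S)); apply/eqP; rewrite -oppr_eq0 -js j0.
have [h hP] := Ii.2 _ _ _ (j \o lfst M (submod S)) (fin_gen_prod fM (noeth fI S)) fI cI.
have hj m : h (j m) = j m by have := hP (m, 0); rewrite /= linear0 addr0.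
have hS s : h (@incl _ _ S s) = 0 by have := hP (0, s); rewrite /= linear0 add0r.
have [c [cE cI' _]] := bij (e \o h) (fun m => etrans (congr1 e (hj m)) (ej m))
  (fun x => mem_imS e (h x)).
have [z zE] := inclP (SE _ yS); have [s sE] := inclP yS.
move/eqP: y0; apply; rewrite -zE (_ : z = 0) ?linear0//; apply: (inj_eq0 cI').
by apply: incl_inj; rewrite cE linear0 /= zE -sE hS linear0.
Qed.

(** Hulls and minimal coresolutions are cut out of a given coresolution; the Gorenstein hypothesis
    supplies one for the regular module. *)
Definition coresolvable M : Prop :=
  exists (I : nat -> lmodType R) (eta : {linear M -> I 0%N})
         (d : forall j, {linear I j -> I j.+1}), injective_coresolution eta d.

Lemma exact_pairP A B C (f : {linear A -> B}) (g : {linear B -> C}) :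
  exact_pair f g <-> forall y, g y = 0 <-> exists x, f x = y.
Proof.
split=> [e y|e].
  have /= <- := congr1 (fun S => S y) e.
  by split=> [[x _ <-]|[x <-]]; exists x.
apply/seteqP; split=> [y [x _ <-]|y /e[x <-]]; last by exists x.
by apply/e; exists x.
Qed.

Lemma kernel_injective I E (r : {linear I -> E}) (s : {linear E -> I}) :
  (forall x, r (s x) = x) -> injective_module I -> injective_module (submod (kerS r)).
Proof.
move=> rs Ii.
have H x : exists y, @incl _ _ (kerS r) y = (idfun \- (s \o r)) x.
  by apply: inclP; apply/kerSP; rewrite /= linearB /= rs subrr.
have [t tE] := lift_inj (@incl_inj _ _ (kerS r)) H.
apply: (injective_retract (s := incl) (r := t)) Ii => x.
apply: incl_inj; rewrite tE /=; have /kerSP-> := incl_mem x.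
by rewrite linear0 subr0.
Qed.

(** [I 0] is the direct sum of the hull [E] of [M] and a complement [E'], which [d 0] embeds as a
    direct summand of [I 1]. Cancelling [E'] leaves a coresolution of the cokernel of [M -> E]. *)
Lemma hull_step M : coresolvable M ->
  exists E A (i : {linear M -> E}) (p : {linear E -> A}),
    [/\ injective_module E, ses i p, essential_image i & coresolvable A].
Proof.
move=> [I [eta [d [Ii etaI /exact_pairP ex0 ex]]]].
have {}ex j : forall y, d j.+1 y = 0 <-> exists x, d j x = y by apply/exact_pairP.
have [E0 [r [rE etaE ess]]] := injective_hull etaI (Ii 0%N).
pose E : lmodType R := submod E0.
have Einj : injective_module E := injective_retract rE (Ii 0%N).
have [i iE] := lift_inj (@incl_inj _ _ E0) (fun m => inclP (etaE m)).
pose pi : {linear E -> I 1%N} := d 0%N \o incl.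
have [p [pE ps]] := corestrict_im pi.
pose A : lmodType R := submod (imS pi).
exists E, A, i, p; split=> //.
- split=> // [x y xy|b]; first by apply: etaI; rewrite -!iE xy.
  have -> : p b = 0 <-> d 0%N (incl b) = 0.
    rewrite -[d 0%N _]pE; split=> [->|/(inj_eq0 (@incl_inj _ _ _))//].
    by rewrite linear0.
  rewrite ex0; split=> [[m mb]|[m <-]]; exists m; last by rewrite iE.
  by apply: incl_inj; rewrite iE.
- move=> S [y yS y0].
  have [||m /imSP[s sE] m0] := ess (imS (@incl _ _ E0 \o @incl _ _ S)).
  + by move=> z /imSP[x <-]; exact: incl_mem.
  + have [s sE] := inclP yS; exists (incl y).
      by apply/imSP; exists s; rewrite /= sE.
    by apply: contra_neq y0; exact: (inj_eq0 (@incl_inj _ _ _)).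
  have im : i m = incl s by apply: incl_inj; rewrite iE -sE.
  exists m; first by rewrite im incl_mem.
  by apply: contra_neq m0; rewrite -iE => ->; rewrite linear0.
pose E' : lmodType R := submod (kerS r).
have E'inj : injective_module E' := kernel_injective rE (Ii 0%N).
pose beta : {linear E' -> I 1%N} := d 0%N \o incl.
(* The images of [E] and [E'] under [d 0] meet trivially, because the kernel of [d 0] is [M], which
   lies in [E]. *)
have cross (a : E) (x : E') : d 0%N (incl a) + beta x = 0 -> x = 0.
  rewrite /beta /= -linearD => /ex0[m mE].
  apply: (inj_eq0 (@incl_inj _ _ _)).
  have r0 : r (incl x) = 0 by apply/kerSP; exact: incl_mem.
  have ai : a = i m.
    by rewrite -[a]addr0 -r0 -[a in LHS]rE -linearD -mE -iE rE.
  by move/eqP: mE; rewrite -iE ai -subr_eq0 opprD addrA subrr add0r oppr_eq0 => /eqP.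
have cI : injective (copair (@incl _ _ (imS pi)) beta).
  apply: linear_inj => -[a x] /= ax; have [b ba] := ps a.
  have x0 : x = 0 by apply: (cross b); rewrite -[d 0%N _]pE ba.
  move: ax; rewrite x0 linear0 linear0 addr0 => /(inj_eq0 (@incl_inj _ _ _))->.
  by [].
have fA : fin_gen A := fin_gen_im _ Einj.1.
(* [sg] retracts [I 1] onto the copy of [E'] and kills [A]; its kernel [I'] takes the place of
   [I 1]. *)
have [sg sgP] := (E'inj.2) _ _ _ (lsnd A E') (fin_gen_prod fA E'inj.1) (Ii 1%N).1 cI.
have sgA a : sg (@incl _ _ (imS pi) a) = 0.
  by have := sgP (a, 0); rewrite /= !linear0 addr0.
have sgB x : sg (beta x) = x by have := sgP (0, x); rewrite /= !linear0 add0r.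
pose I' : lmodType R := submod (kerS sg).
have I'inj : injective_module I' := kernel_injective sgB (Ii 1%N).
have [eta' eta'E] := lift_inj (@incl_inj _ _ (kerS sg))
  (fun a => inclP ((kerSP sg _).2 (sgA a))).
pose J j : lmodType R := if j is j'.+1 then I j'.+2 else I'.
exists J, eta', (fun j => match j return {linear J j -> J j.+1} with
  | 0%N => (d 1%N \o incl : {linear I' -> I 2%N}) | j'.+1 => d j'.+2 end).
split.
- by case=> // j; exact: Ii.
- by move=> a b ab; apply: incl_inj; rewrite -!eta'E ab.
- apply/exact_pairP => y; split=> [/= /ex[x xy]|[a <-]] /=.
    have [x' x'E] : exists x', @incl _ _ (kerS r) x' = x - incl (r x).
      by apply: inclP; apply/kerSP; rewrite linearB /= rE subrr.
    have x'0 : x' = 0.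
      have /kerSP := incl_mem y; rewrite -xy -[x](subrK (incl (r x))) -x'E.
      rewrite linearD linearD /= -[d 0%N (incl (r x))]pE sgA addr0.
      by move=> h; rewrite -[x']sgB.
    exists (p (r x)); apply: incl_inj; rewrite eta'E pE -xy /=.
    by rewrite -[x in RHS](subrK (incl (r x))) -x'E x'0 linear0 add0r.
  rewrite eta'E; have [b <-] := ps a; rewrite pE.
  by apply/ex; exists (incl b).
- case=> [|j]; apply/exact_pairP => y /=; last exact: ex.
  rewrite ex; split=> [[z <-]|[x <-]]; last by exists (incl x).
  have [x xE] : exists x, @incl _ _ (kerS sg) x = z - beta (sg z).
    by apply: inclP; apply/kerSP; rewrite linearB /= sgB subrr.
  exists x; rewrite /= xE linearB /= (_ : d 1%N (d 0%N _) = 0) ?subr0//.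
  by apply/ex; exists (incl (sg z)).
Qed.

Lemma minimal_coresolution_exists M : coresolvable M ->
  exists (I : nat -> lmodType R) (eta : {linear M -> I 0%N})
         (d : forall j, {linear I j -> I j.+1}), minimal_injective_coresolution eta d.
Proof.
move=> cM; pose T := {N : lmodType R | coresolvable N}.
have stp (N : T) : {w : {E : lmodType R & {A : T &
    ({linear sval N -> E} * {linear E -> sval A})%type}} |
    [/\ injective_module (projT1 w), ses (projT2 (projT2 w)).1 (projT2 (projT2 w)).2 &
      essential_image (projT2 (projT2 w)).1]}.
  apply: cid; have [E [A [i [p [Ei s ess cA]]]]] := hull_step (svalP N).
  by exists (existT _ E (existT _ (exist _ A cA) (i, p))).
pose w (N : T) := sval (stp N).
pose nx (N : T) : T := projT1 (projT2 (w N)).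
pose S j := iter j nx (exist _ M cM).
pose I j := projT1 (w (S j)).
pose i j : {linear sval (S j) -> I j} := (projT2 (projT2 (w (S j)))).1.
pose p j : {linear I j -> sval (S j.+1)} := (projT2 (projT2 (w (S j)))).2.
have wP j : [/\ injective_module (I j), ses (i j) (p j) & essential_image (i j)].
  exact: (svalP (stp (S j))).
pose d j : {linear I j -> I j.+1} := i j.+1 \o p j.
have d0 j y : d j y = 0 <-> exists a, i j a = y.
  have [_ [_ _ e] _] := wP j; have [_ [iI _ _] _] := wP j.+1.
  by rewrite -e; split=> [/= /(inj_eq0 iI)//|h]; rewrite /d /= h linear0.
exists I, (i 0%N), d; split; last first.
- move=> j; have [_ [_ ps _] _] := wP j; have [_ _ ess] := wP j.+1.
  move=> V /ess[a aV a0]; have [x xa] := ps a.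
  by exists x; rewrite /d /= xa.
- by have [] := wP 0%N.
split=> [j|||j]; first by have [] := wP j.
- by have [_ []] := wP 0%N.
- by apply/exact_pairP => y; exact: d0.
apply/exact_pairP => y; rewrite d0; have [_ [_ ps _] _] := wP j.
split=> [[a <-]|[x <-]]; last by exists (p j x).
by have [x <-] := ps a; exists x.
Qed.

(** A minimal nonzero submodule of [S] is simple. *)
Lemma socle_essential M (S : submodClosed M) : fin_gen M ->
  (exists2 y, y \in S & y != 0) ->
  exists2 y, y \in S & y \in @socle_pred _ M /\ y != 0.
Proof.
move=> fM [y yS y0].
have [|T [[TS [t tT t0]] Tmin]] := @artinian_minimal _ _
  (fun T : submodClosed M => {subset T <= S} /\ exists2 y, y \in T & y != 0) S (art fM).
  by split=> //; exists y.
exists t; first exact: TS.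
split=> //; apply/asboolP; exists [:: t]; last by rewrite big_seq1.
move=> u; rewrite inE => /eqP->; exists T => //; split.
  move=> z; have [t' t'E] := inclP tT; move: t0.
  by rewrite -t'E (z t') linear0 eqxx.
move=> U; case: (pselect (exists2 x, x \in U & x != 0)) => [[x xU x0]|nU]; last first.
  left=> x xU; apply: contrapT => /eqP x0; apply: nU; by exists x.
right=> v; have VT : {subset imS (@incl _ _ T \o @incl _ _ U) <= T}.
  by move=> z /imSP[a <-]; exact: incl_mem.
suff /Tmin/(_ VT _ (incl_mem v))/imSP[a aE] :
    {subset imS (@incl _ _ T \o @incl _ _ U) <= S} /\
    exists2 y, y \in imS (@incl _ _ T \o @incl _ _ U) & y != 0.
- by have <- : incl a = v; [exact: incl_inj | exact: incl_mem].
- split; first by move=> z /VT/TS.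
  have [x' x'E] := inclP xU; exists (incl x).
    by apply/imSP; exists x'; rewrite /= x'E.
  by apply: contra_neq x0; exact: (inj_eq0 (@incl_inj _ _ _)).
Qed.

(** A simple submodule meets the essential image nontrivially, hence lies in it. *)
Lemma socle_sub_essential X M (i : {linear X -> M}) x : essential_image i ->
  x \in @socle_pred _ M -> exists a, i a = x.
Proof.
move=> ess /asboolP[s sS ->]; apply/imSP; rewrite big_seq; apply: rpred_sum => y.
move=> /sS[S [_ Ssim] yS]; have [y0|/eqP y0] := pselect (y = 0).
  by rewrite y0 rpred0.
have [|a aS a0] := ess S; first by exists y.
have U0 : @incl _ _ S 0 \in imS i by rewrite linear0 rpred0.
have Ul c (u v : submod S) : incl u \in imS i -> incl v \in imS i ->
    incl (c *: u + v) \in imS i.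
  by move=> ui vi; rewrite linearP rpredD ?rpredZ.
have [z|full] := Ssim (submod_of U0 Ul); last first.
  by have [t <-] := inclP yS; exact: (in_submod_of U0 Ul t).1 (full t).
have [t tE] := inclP aS; case/eqP: a0; rewrite -tE (z t) ?linear0//.
by apply/in_submod_of; rewrite tE mem_imS.
Qed.

End Hulls.

(** * The socle condition and projectivity of injective modules *)

Section Main.
Variable L : nzRingType.
Hypothesis noeth : fg_noetherian L.
Hypothesis noethc : fg_noetherian L^c.
Hypothesis art : fg_artinian L.
Hypothesis rdim : finite_right_dim L.
Variables (I : nat -> lmodType L) (eta : {linear (L^o : lmodType L) -> I 0%N})
  (d : forall j, {linear I j -> I j.+1}).
Hypothesis cres : injective_coresolution eta d.
Variable n : nat.
Let Z := cosyz (L^o : lmodType L) d.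
Let cz := cosyz_of_coresolution cres.
Hypothesis Zn1 : injective_module (Z n.+1).
Implicit Types J N : lmodType L.

Lemma fin_gen_soc J : fin_gen J -> fin_gen (soc J).
Proof. by move=> fJ; exact: noeth. Qed.

Lemma Gpd_socP J : fin_gen J -> Gpd_le (soc J) n <-> ext1z (soc J) (Z n).
Proof.
by move=> fJ; exact: (Gpd_leP noeth noethc rdim cz (fun _ => iff_refl _) Zn1 (fin_gen_soc fJ)).
Qed.

Lemma Gpd_soc_prinj J : prinj J -> Gpd_le (soc J) n.
Proof.
move=> [Jp Ji]; apply/(Gpd_socP Ji.1); have [Ii s] := cz n.
apply: (ext1z_of_lift s Ii) => u.
have [v vE] := Zn1.2 _ _ _ u (fin_gen_soc Ji.1) Ji.1 (@incl_inj _ _ (@socle_pred _ J)).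
have [_ ps _] := s.
have [w wE] := projective_lift v Jp Ii.1 ps.
by exists (w \o incl) => x; rewrite /= wE vE.
Qed.

Lemma projective_of_Gpd_soc J : (forall j, (j <= n)%N -> projective_module (I j)) ->
  injective_module J -> Gpd_le (soc J) n -> projective_module J.
Proof.
move=> Ip Ji /(Gpd_socP Ji.1) NZ; set N := soc J in NZ.
have fN : fin_gen N := fin_gen_soc Ji.1.
have Iinj j : injective_module (I j) by have [] := cz j.
pose Phi (S : submodClosed N) := exists (Q : lmodType L) (f : {linear N -> Q}),
  [/\ projective_module Q, injective_module Q & S =i kerS f].
have [|S [[Q [f [Qp Qi SE]]] Smin]] := @artinian_minimal _ _ Phi
    (kerS (\0 : {linear N -> I 0%N})) (art fN).
  by exists (I 0%N), \0; split=> //; exact: Ip.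
pose K : lmodType L := submod S.
(* Adjoining [u] to [f] gives a map to a projective injective module with a smaller kernel; by
   minimality [u] vanishes on [K]. *)
have kill j (u : {linear N -> I j}) : (j <= n)%N -> forall x : K, u (incl x) = 0.
  move=> jn x.
  have PQ : Phi (kerS (pair_map f u)).
    exists (Q * I j)%type, (pair_map f u); split=> //.
      exact: projective_prod (Ip j jn).
    exact: injective_prod.
  have sub : {subset kerS (pair_map f u) <= S}.
    by move=> y /kerSP[fy _]; rewrite SE; apply/kerSP.
  by have /kerSP[] := Smin _ PQ sub _ (incl_mem x).
have fK : fin_gen K := noeth fN S.
have HomI j (v : {linear K -> I j}) x : (j <= n)%N -> v x = 0.
  move=> jn; have [w wE] := (Iinj j).2 _ _ _ v fK fN (@incl_inj _ _ S).
  by rewrite -wE kill.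
have HomZ j (v : {linear K -> Z j}) x : (j <= n)%N -> v x = 0.
  move=> jn; have [_ [iI _ _]] := cz j; apply: (inj_eq0 iI).
  exact: (HomI j (cosyz_incl eta d j \o v)).
have [In s] := cz n.
have KZ : ext1z K (Z n).
  exact: (ext1z_sub noeth (@incl_inj _ _ S) fN s In Zn1 NZ).
(* At the extra index [n.+1] the map lifts to [I n], where it is zero. *)
have HomZ1 j (v : {linear K -> Z j}) x : (j <= n.+1)%N -> v x = 0.
  rewrite leq_eqVlt => /orP[/eqP jn|]; last by rewrite ltnS; exact: HomZ.
  subst j; have [w wE] := ext1z_lift noeth fK s KZ v.
  by rewrite -wE HomI// linear0.
(* Up to [n] there is no nonzero map to [Z j.+1] to be lifted; beyond [n] the injectivity of
   [Z n.+1] suffices. *)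
have pK : perp Z K.
  split=> // j; case: (leqP j n) => jn; last exact: (cosyz_ge noeth cz Zn1 jn fK).
  have [Ij sj] := cz j; apply: (ext1z_of_lift sj Ij) => u.
  by exists \0 => x; rewrite (HomZ1 j.+1 u x)//= linear0.
have K0 (x : K) : x = 0.
  apply: (perp_torsionless noeth rdim cz (fun _ => iff_refl _) pK) => phi.
  exact: (HomZ 0%N phi).
have fI : injective f.
  apply: linear_inj => x fx.
  have [|y <-] := @inclP _ _ S x; first by rewrite SE; apply/kerSP.
  by rewrite (K0 y) linear0.
have [F FE] := Qi.2 _ _ _ f fN Ji.1 (@incl_inj _ _ (@socle_pred _ J)).
(* A nonzero kernel of [F] would meet the socle, on which [F] is the injective map [f]. *)
have FI : injective F.
  apply: linear_inj => x Fx; apply: contrapT => /eqP x0.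
  have [|y yF [ysoc]] := socle_essential art (S := kerS F) Ji.1.
    by exists x => //; apply/kerSP.
  have [y' y'E] := inclP ysoc; move/eqP; apply; rewrite -y'E.
  rewrite (_ : y' = 0) ?linear0//; apply: (inj_eq0 fI).
  by rewrite -FE y'E; apply/kerSP.
have [r rE] := Ji.2 _ _ F (idfun : {linear J -> J}) Ji.1 Qi.1 FI.
exact: (projective_retract rE Qp).
Qed.

(** Both arguments are shifted by one at a time; the terms [I i] serve as projectives on the left
    and as injectives on the right. *)
Lemma ext1z_cosyz j m : (forall i, (i < j)%N -> projective_module (I i)) ->
  ext1z (Z j) (Z (m + j)%N).
Proof.
elim: j => [|j IH] Ip.
  apply: ext1z_projective; split=> [|A B p f fA fB ps].
    by exists 1%N, (fun=> 1) => x; exists (fun=> x); rewrite big_ord1 /GRing.scale /= mulr1.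
  have [a aE] := ps (f 1).
  have al : linear (fun x : L^o => (x : L) *: a) by move=> c u v; rewrite scalerDl scalerA.
  exists (linear_of al) => x; rewrite /= linearZ /= aE -linearZ /=.
  by rewrite /GRing.scale /= mulr1.
have [Ij s] := cz j; have [Ijm sm] := cz (m + j).
rewrite addnS; apply: (ext1z_shift_up noeth s sm Ij.1 Ijm).
  by apply: IH => i ij; apply: Ip; exact: ltnW.
exact/ext1z_projective/Ip.
Qed.

Lemma coresolution_projective : essential_image eta -> (forall j, essential_image (d j)) ->
  (forall J, injective_module J -> Gpd_le (soc J) n -> projective_module J) ->
  forall j, (j <= n)%N -> projective_module (I j).
Proof.
move=> ess0 ess H j; have [m] := ubnP j; elim: m j => // m IH j; rewrite ltnS => jm jn.
have Ip i : (i < j)%N -> projective_module (I i).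
  by move=> ij; apply: IH; [exact: leq_trans jm | exact: leq_trans (ltnW ij) jn].
have [Ij s] := cz j.
have essj : essential_image (cosyz_incl eta d j).
  case: j {jm jn Ip Ij s} => [|j] //= S /ess[x xS x0].
  by have [y yE] := inclP (mem_imS (d j) x); exists y; rewrite yE.
apply: H => //; apply/(Gpd_socP Ij.1).
(* [Z j] is essential in [I j], so it contains the socle. *)
have inZ x : exists a, cosyz_incl eta d j a = @incl _ _ (@socle_pred _ (I j)) x.
  by apply: (socle_sub_essential essj); exact: incl_mem.
have [iI _ _] := s; have [e eE] := lift_inj iI inZ.
have eI : injective e by move=> x y xy; apply: incl_inj; rewrite -!eE xy.
have [In sn] := cz n.
apply: (ext1z_sub noeth eI (cosyz_fin_gen noeth j cz) sn In Zn1).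
by rewrite -(subnK jn); exact: ext1z_cosyz.
Qed.

End Main.

(** Injectivity of the [m]-th cosyzygy does not depend on the coresolution, so a bound read off from
    one applies to a minimal one. *)
Lemma cosyz_injective_compare (L : nzRingType) (noeth : fg_noetherian L) m
   (I : nat -> lmodType L) (eta : {linear (L^o : lmodType L) -> I 0%N}) d :
  has_injective_coresolution_of_length (L^o : lmodType L) m ->
  injective_coresolution eta d -> injective_module (cosyz (L^o : lmodType L) d m).
Proof.
move=> [I' [eta' [d' [cr' z]]]] cr.
have cz := cosyz_of_coresolution cr; have cz' := cosyz_of_coresolution cr'.
apply: (injective_of_ext1z noeth (cosyz_fin_gen noeth m cz)) => N fN.
apply: (cosyz_compare noeth cz' cz _ fN) => //.
exact: (ext1z_injective (cosyz_injective noeth cr' z)).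
Qed.

Theorem theorem2 (n : nat) (n_gt0 : (0 < n)%N) (k : comNzRingType)
    (L : algType k) (L_artin : artin_algebra L) (L_basic : basic L)
    (L_gor : gorenstein L n.+1) :
  minimal_auslander_gorenstein L n <->
  (forall I : lmodType L, prinj I <-> injective_module I /\ Gpd_le (soc I) n).
Proof.
have noeth := artin_algebra_noetherian L_artin.
have noethc := artin_algebra_converse_noetherian L_artin.
have art := artin_algebra_artinian L_artin.
have [[Lid _] [[Ir [etar [dr [crr zr]]]] _]] := L_gor.
have rdim : finite_right_dim L.
  move=> F d; apply: (cosyz_extend (cosyz_of_coresolution crr)).
  exact: (cosyz_injective noethc crr zr).
split=> [[_ dd]|H].
  (* The dominant dimension is encoded through upper bounds; as [n] cannot be one, some member of
     [domdim_set] exceeds it. *)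
  have [e [I [eta [d [[cr _ _] Ip]]]] ne] : exists2 e, domdim_set L e & (n < e)%N.
    apply: contrapT => h; have : (n.+1 <= n)%N.
      apply: dd => e de; rewrite leqNgt; apply/negP => ne; apply: h; by exists e.
    by rewrite ltnn.
  have Zn1 := cosyz_injective_compare noeth Lid cr.
  move=> J; split=> [pJ|[Ji GJ]].
    split; first exact: pJ.2.
    exact: (Gpd_soc_prinj noeth noethc rdim cr Zn1 pJ).
  split=> //; apply: (projective_of_Gpd_soc noeth noethc art rdim cr Zn1) GJ => // j jn.
  by apply: Ip; exact: leq_ltn_trans ne.
split; first by exists n.+1.
have cL : coresolvable (L^o : lmodType L).
  by have [I [eta [d [cr _]]]] := Lid; exists I, eta, d.
have [I [eta [d mcr]]] := minimal_coresolution_exists noeth art cL.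
have [cr ess0 ess] := mcr.
have Zn1 := cosyz_injective_compare noeth Lid cr.
(* It suffices that [n.+1] itself belongs to [domdim_set]. *)
move=> b; apply; exists I, eta, d; split=> // j jn.
apply: (coresolution_projective noeth noethc rdim cr Zn1 ess0 ess) jn => J Ji GJ.
by have [] := (H J).2 (conj Ji GJ).
Qed.
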